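(* Let $\Phi$ be a commutative ring with unity $1\neq 0$, and let $\Delta$ be a basic set of derivation operators containing at least two elements. Then the subalgebra membership problem for differential polynomial algebras $\Phi\{x_1,\ldots,x_n\}$ (with respect to $\Delta$) is algorithmically undecidable: there is no algorithm which, for every finite sequence of differential polynomials $f,f_1,\ldots,f_k\in\Phi\{x_1,\ldots,x_n\}$, determines whether $f$ belongs to the differential subalgebra generated by $f_1,\ldots,f_k$.
   Context: $\Delta=\{\delta_1,\ldots,\delta_m\}$ is a set of symbols for commuting derivations. $\Phi$ is regarded as a differential ring on which all $\delta_i$ act as zero. The differential polynomial ring $\Phi\{x_1,\ldots,x_n\}$ is the polynomial ring over $\Phi$ in the algebraically independent variables $\theta(x_i)$, where $1\le i\le n$ and $\theta=\delta_1^{j_1}\cdots\delta_m^{j_m}$ ranges over the free commutative monoid generated by $\Delta$; each $\delta_l$ acts as the unique derivation with $\delta_l(\theta(x_i))=(\delta_l\theta)(x_i)$ and $\delta_l(\Phi)=0$. The differential subalgebra generated by a set is the smallest $\Phi$-subalgebra (with unity) containing the set and closed under all $\delta_l$. *)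

(* Defs.v *)
From HB Require Import structures.
From mathcomp Require Import all_boot all_order all_algebra.
From mathcomp Require Import finmap.
From mathcomp Require Import monalg.

Set Implicit Arguments.
Unset Strict Implicit.
Unset Printing Implicit Defensive.

Import GRing.Theory.
Local Open Scope ring_scope.

(* A differential variable theta(x_i): the index i : 'I_n and the      *)
(* exponent vector (j_1,...,j_m) of theta = delta_1^j_1 ... delta_m^j_m *)
Definition dvar (m n : nat) := ('I_n * m.-tuple nat)%type.

(* Phi{x_1..x_n}: the commutative polynomial ring over Phi in the      *)
(* algebraically independent variables theta(x_i).                     *)
Definition dpoly (R : comNzRingType) (m n : nat) := {malg R[{cmonom dvar m n}]}.

Definition dX (R : comNzRingType) (m n : nat) (i : 'I_n) (th : m.-tuple nat)
  : dpoly R m n := << ucm ((i, th) : dvar m n) >>.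

Definition shiftv (m n : nat) (l : 'I_m) (v : dvar m n) : dvar m n :=
  (v.1, [tuple (tnth v.2 j + (j == l))%N | j < m]).

Definition dermonom (R : comNzRingType) (m n : nat) (l : 'I_m)
  (k : {cmonom dvar m n}) : dpoly R m n :=
  \sum_(v <- finsupp k)
     (k v)%:R *: << mulcm (divcm k (ucm v)) (ucm (shiftv l v)) >>.

(* delta_l on Phi{x}: the Phi-linear extension of the above, i.e. the  *)
(* unique derivation with delta_l(theta x_i) = (delta_l theta) x_i and  *)
(* delta_l(Phi) = 0.                                                    *)
Definition dderiv (R : comNzRingType) (m n : nat) (l : 'I_m)
  (p : dpoly R m n) : dpoly R m n :=
  \sum_(k <- msupp p) p@_k *: dermonom R l k.

Definition in_dsubalg (R : comNzRingType) (m n : nat)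
  (S : seq (dpoly R m n)) (f : dpoly R m n) : Prop :=
  forall P : dpoly R m n -> Prop,
    P 1 ->
    (forall (a : R) p, P p -> P (a *: p)) ->
    (forall p q, P p -> P q -> P (p + q)) ->
    (forall p q, P p -> P q -> P (p * q)) ->
    (forall (l : 'I_m) p, P p -> P (dderiv l p)) ->
    (forall s, s \in S -> P s) ->
    P f.

(* 2. Finite descriptions of differential polynomials (inputs).        *)
(*    Coefficients are integers (images n%:~R of Z in Phi); every       *)
(*    differential polynomial with coefficients in the prime subring    *)
(*    is the value of such a term.                                      *)

Inductive dterm (m n : nat) : Type :=
| TConst of int
| TVar of 'I_n & m.-tuple nat
| TAdd of dterm m n & dterm m n
| TMul of dterm m n & dterm m n.

Fixpoint teval (R : comNzRingType) (m n : nat) (t : dterm m n) : dpoly R m n :=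
  match t with
  | TConst z => z%:~R
  | TVar i th => dX R i th
  | TAdd a b => teval R a + teval R b
  | TMul a b => teval R a * teval R b
  end.

Definition instance (m : nat) :=
  {n : nat & (dterm m n * seq (dterm m n))%type}.

Definition member (R : comNzRingType) (m : nat) (I : instance m) : Prop :=
  in_dsubalg [seq teval R t | t <- (projT2 I).2] (teval R (projT2 I).1).

(* Explicit (injective, obviously computable) Goedel numbering. *)
Definition cpair (a b : nat) : nat := (((a + b) * (a + b).+1)./2 + b)%N.

Definition enc_int (z : int) : nat :=
  match z with Posz k => k.*2 | Negz k => k.*2.+1 end%N.

Fixpoint enc_seq (s : seq nat) : nat :=
  match s with [::] => 0%N | x :: s' => (cpair x (enc_seq s')).+1 end.

Fixpoint enc_term (m n : nat) (t : dterm m n) : nat :=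
  match t with
  | TConst z => 4 * enc_int z
  | TVar i th => 4 * cpair (nat_of_ord i) (enc_seq th) + 1
  | TAdd a b => 4 * cpair (enc_term a) (enc_term b) + 2
  | TMul a b => 4 * cpair (enc_term a) (enc_term b) + 3
  end%N.

Definition enc_instance (m : nat) (I : instance m) : nat :=
  cpair (projT1 I)
    (cpair (enc_term (projT2 I).1) (enc_seq (map (@enc_term m _) (projT2 I).2))).

Inductive instr : Type :=
| INC of nat
| JZDEC of nat & nat.

Definition config := (nat * (nat -> nat))%type.

Definition upd (f : nat -> nat) (r v : nat) : nat -> nat :=
  fun x => if x == r then v else f x.

Definition step (prog : seq instr) (c : config) : config :=
  let: (pc, regs) := c in
  match nth (INC 0) prog pc with
  | _ as ins =>
    if (pc < size prog)%N then
      match ins with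
      | INC r => (pc.+1, upd regs r (regs r).+1)
      | JZDEC r j =>
          if regs r == 0%N then (j, regs) else (pc.+1, upd regs r (regs r).-1)
      end
    else c
  end.

Definition run (prog : seq instr) (k : nat) (c : config) : config :=
  iter k (step prog) c.

Definition init (x : nat) : config := (0%N, fun r => if r == 0%N then x else 0%N).

Definition halts_with (prog : seq instr) (x y : nat) : Prop :=
  exists k, let c := run prog k (init x) in
            (size prog <= c.1)%N /\ c.2 0%N = y.

Definition decides (A : Type) (enc : A -> nat) (P : A -> Prop)
  (prog : seq instr) : Prop :=
  forall a, exists y, halts_with prog (enc a) y /\ (y = 1%N <-> P a).

(* Main.v *)
(* A configuration of a register machine - state s, registers coded by the
   exponents of distinct primes in a number N - becomes the monomial
   u v a^N(x_s), where a, b are the first two derivations.  Modulo b x_s =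
   a^d x_s, the element a^e b^j x_s is a^(e + d j) x_s.  As b u = 0, the
   relation u (a^e x_s - a^e' x_s') may be differentiated by b but not by a,
   so it moves (s, e + d j) to (s', e' + d' j) for every j: this divides,
   multiplies and tests divisibility.  As a v = 0, the relation
   v (a^e x_s - a^e' x_s') similarly moves (s, e + i) to (s', e' + i) for
   every i.  A marker t whose derivatives are generators turns membership in
   this differential ideal into membership in a subalgebra.
   Conversely, the separating linear functional is the one killing all total
   derivatives ("integration by parts"), whose value on u v a^N(x_s) tells
   whether the configuration runs forever.
   No universal machine is needed: the code c of the generator list of a
   program Q serves as the input of Q, so that Q only has to pair up numbers
   to build the instance "Q halts on c", ask the decision program about it and
   do the opposite. *)
Require Import Defs.
From mathcomp Require Import all_boot all_algebra.
From mathcomp Require Import finmap monalg boolp zify ring.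

Set Implicit Arguments.
Unset Strict Implicit.
Unset Printing Implicit Defensive.

Import GRing.Theory.
Local Open Scope fset.
Local Open Scope ring_scope.

(** * Monomials and derivations *)

Section Weights.
Context (X : choiceType).
Implicit Types (w : X -> nat) (k : {cmonom X}) (v : X).

Definition wt w k : nat := (\sum_(v <- finsupp k) k v * w v)%N.

Lemma wtEw (d : {fset X}) w k : finsupp k `<=` d ->
  wt w k = (\sum_(v <- d) k v * w v)%N.
Proof.
move=> le; rewrite /wt (big_fset_incl _ le) // => v vd.
by rewrite -cmE_neq0 negbK => /eqP ->.
Qed.

Lemma wtU w v : wt w (ucm v) = w v.
Proof. by rewrite /wt mdomU big_seq_fset1 cmUU mul1n. Qed.

Lemma wt1 w : wt w (onecm X) = 0%N.
Proof. by rewrite /wt (@mdom1 X) big_seq_fset0. Qed.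

Lemma wtD w w' k : wt (fun v => w v + w' v)%N k = (wt w k + wt w' k)%N.
Proof. by rewrite /wt -big_split; apply: eq_bigr => v _; rewrite mulnDr. Qed.

Lemma wtM w k1 k2 : wt w (mulcm k1 k2) = (wt w k1 + wt w k2)%N.
Proof.
rewrite /wt (mdomD k1 k2) -!/(wt _ _).
rewrite (wtEw w (fsubsetUl _ (finsupp k2))) (wtEw w (fsubsetUr (finsupp k1) _)).
by rewrite -big_split /=; apply: eq_bigr => v _; rewrite mulcmE mulnDl.
Qed.

Lemma wt_eq0 w w' k : (forall v, w' v = 0 -> w v = 0)%N ->
  wt w' k = 0%N -> wt w k = 0%N.
Proof.
move=> ww' /eqP; rewrite !/(wt _ _) sum_nat_seq_eq0 => /allP wk.
apply/eqP; rewrite sum_nat_seq_eq0; apply/allP => v /wk.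
by rewrite !implyTb !muln_eq0 => /orP[->//|/eqP/ww' ->]; rewrite orbT.
Qed.

Lemma divcmK k v : v \in finsupp k -> mulcm (divcm k (ucm v)) (ucm v) = k.
Proof.
rewrite -cmE_neq0 => kv; apply/eqP/cmP => v'.
by rewrite mulcmE divcmE ucmE; case: eqVneq => [<-|_] /=;
  rewrite ?subnK ?lt0n // subn0 addn0.
Qed.

(** This tracks how each statistic of a monomial changes in one term of a derivation, where [v'] is
    the derivative of [v]. *)
Lemma wt_subst w k v v' c : v \in finsupp k -> w v' = (w v + c)%N ->
  wt w (mulcm (divcm k (ucm v)) (ucm v')) = (wt w k + c)%N.
Proof. by move=> kv wv'; rewrite -{2}(divcmK kv) !wtM !wtU wv' addnA. Qed.

End Weights.

(* From here to [separation], the differential polynomials are an abstract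
   algebra [A] with a monomial basis [e]: unification on the concrete type
   {malg R[{cmonom dvar m n}]} diverges too easily. *)
Section MonomialDerivation.
Context (R : comNzRingType) (A : comAlgType R) (X : choiceType).
Context (e : {cmonom X} -> A).
Hypothesis eM : forall k1 k2, e (mulcm k1 k2) = e k1 * e k2.
Hypothesis e_ind : forall P : A -> Prop, P 0 ->
  (forall p q, P p -> P q -> P (p + q)) -> (forall c k, P (c *: e k)) ->
  forall p, P p.
Context (sh : X -> X) (D : A -> A).

Definition dermon (k : {cmonom X}) : A := \sum_(v <- finsupp k)
  (k v)%:R *: e (mulcm (divcm k (ucm v)) (ucm (sh v))).

Hypothesis DD : forall p q, D (p + q) = D p + D q.
Hypothesis DU : forall c k, D (c *: e k) = c *: dermon k.

Lemma dermonEw (d : {fset X}) (k : {cmonom X}) : finsupp k `<=` d ->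
  dermon k = \sum_(v <- d)
     (k v)%:R *: e (mulcm (divcm k (ucm v)) (ucm (sh v))).
Proof.
move=> le; rewrite /dermon (big_fset_incl _ le) // => v vd.
by rewrite -cmE_neq0 negbK => /eqP ->; rewrite scale0r.
Qed.

Lemma dermonU v : dermon (ucm v) = e (ucm (sh v)).
Proof.
rewrite /dermon mdomU big_seq_fset1 cmUU scale1r; congr e.
by apply/eqP/cmP => v'; rewrite mulcmE divcmE subnn.
Qed.

(** The multiplicity of [v] in the product is [k1 v + k2 v], so each term splits in two, with [v]
    removed from one factor. Where that factor lacks [v], the coefficient kills the term and the
    truncated division is harmless. *)
Lemma dermonM k1 k2 :
  dermon (mulcm k1 k2) = dermon k1 * e k2 + e k1 * dermon k2.
Proof.
rewrite {1}/dermon (mdomD k1 k2).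
rewrite (dermonEw (fsubsetUl _ (finsupp k2))).
rewrite (dermonEw (fsubsetUr (finsupp k1) _)).
rewrite mulr_suml mulr_sumr -big_split /=; apply: eq_bigr => v _.
rewrite -scalerAl -scalerAr -!eM mulcmE natrD scalerDl.
congr (_ + _).
- have [->|k1v] := eqVneq (k1 v) 0%N; first by rewrite !scale0r.
  congr (_ *: e _); apply/eqP/cmP => v'.
  rewrite !(mulcmE, divcmE, ucmE); case: eqVneq => [<-|_] /=.
    by rewrite addnAC -addnBAC ?lt0n.
  by rewrite !subn0 addnAC.
have [->|k2v] := eqVneq (k2 v) 0%N; first by rewrite !scale0r.
congr (_ *: e _); apply/eqP/cmP => v'.
rewrite !(mulcmE, divcmE, ucmE); case: eqVneq => [<-|_] /=.
  by rewrite addnA addnBA ?lt0n.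
by rewrite !subn0 addnA.
Qed.

Lemma der0 : D 0 = 0.
Proof. by apply: (addIr (D 0)); rewrite -DD !add0r. Qed.

Lemma derZ c p : D (c *: p) = c *: D p.
Proof.
elim/e_ind: p => [|p q IHp IHq|a k]; first by rewrite scaler0 der0 scaler0.
  by rewrite scalerDr !DD IHp IHq scalerDr.
by rewrite scalerA !DU scalerA.
Qed.

Lemma derN p : D (- p) = - D p.
Proof. by rewrite -scaleN1r derZ scaleN1r. Qed.

Lemma derM p q : D (p * q) = D p * q + p * D q.
Proof.
elim/e_ind: p => [|p p' IHp IHp'|a k].
- by rewrite !mul0r der0 mul0r addr0.
- by rewrite mulrDl !DD IHp IHp' !mulrDl addrACA.
elim/e_ind: q => [|q q' IHq IHq'|b k'].
- by rewrite !mulr0 der0 mulr0 addr0.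
- by rewrite mulrDr !DD IHq IHq' !mulrDr addrACA.
have De k0 : D (e k0) = dermon k0 by rewrite -[e k0]scale1r DU scale1r.
rewrite -scalerAl -scalerAr -eM !derZ !De dermonM.
by rewrite -!scalerAl -!scalerAr -!scalerDr.
Qed.

End MonomialDerivation.

Lemma malgUE (K : choiceType) (R : nzRingType) (c : R) (k : K) :
  << c *g k >> = c *: << k >> :> {malg R[K]}.
Proof.
apply/malgP => k'; rewrite [RHS]mcoeffZ [LHS]mcoeffU (mcoeffU k 1).
by rewrite mulrnAr mulr1.
Qed.

Lemma malg_ind (K : choiceType) (R : nzRingType) (P : {malg R[K]} -> Prop) :
  P 0 -> (forall p q, P p -> P q -> P (p + q)) ->
  (forall c k, P (c *: << k >>)) -> forall p, P p.
Proof.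
move=> P0 PD PU p; rewrite (monalgE p); elim/big_ind: _ => // k _.
by rewrite malgUE; apply: PU.
Qed.

Lemma malg1M (X : choiceType) (R : comNzRingType) (k1 k2 : {cmonom X}) :
  << mulcm k1 k2 >> = << k1 >> * << k2 >> :> {malg R[{cmonom X}]}.
Proof. by rewrite malgM_def fgmulUU mulr1. Qed.

Section Dpoly.
Context (R : comNzRingType) (m n : nat).

Definition dpalg : comAlgType R := {malg R[{cmonom dvar m n}]}.
Definition emon (k : {cmonom dvar m n}) : dpalg := << k >>.
Definition der (l : 'I_m) : dpalg -> dpalg := @dderiv R m n l.

Lemma emonM k1 k2 : emon (mulcm k1 k2) = emon k1 * emon k2.
Proof. exact: malg1M. Qed.

Lemma emon_ind (P : dpalg -> Prop) : P 0 ->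
  (forall p q, P p -> P q -> P (p + q)) -> (forall c k, P (c *: emon k)) ->
  forall p, P p.
Proof. exact: malg_ind. Qed.

Lemma dderiv_mmap l (p : dpoly R m n) :
  dderiv l p = mmap (@malgC _ R) (dermonom R l) p.
Proof. by apply: eq_bigr => k _; rewrite mul_malgC. Qed.

Lemma derD l p q : der l (p + q) = der l p + der l q.
Proof.
rewrite /der !dderiv_mmap. 
exact: (mmapD (f := @malgC _ R) (h := dermonom R l) p q).
Qed.

Lemma derU l c k : der l (c *: emon k) = c *: dermon emon (shiftv l) k.
Proof.
rewrite /der /emon -[c *: _]malgUE dderiv_mmap.
exact: (etrans (mmapU _ _) (mul_malgC c _)).
Qed.

Definition linext (h : {cmonom dvar m n} -> R) (p : dpalg) : R := mmap idfun h p.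

Lemma linextD h p q : linext h (p + q) = linext h p + linext h q.
Proof. exact: (mmapD (f := idfun) (h := h) p q). Qed.

Lemma linextU h c k : linext h (c *: emon k) = c * h k.
Proof. by rewrite /linext -[c *: _]malgUE mmapU. Qed.

Lemma in_dsubalg_alg (S : seq (dpoly R m n)) f : in_dsubalg S f <->
  forall P : dpalg -> Prop, P 1 -> (forall (a : R) p, P p -> P (a *: p)) ->
    (forall p q, P p -> P q -> P (p + q)) ->
    (forall p q, P p -> P q -> P (p * q)) ->
    (forall l p, P p -> P (der l p)) -> (forall s, s \in S -> P s) -> P f.
Proof. by []. Qed.

End Dpoly.

(** * Encoding rewriting rules by generators *)

Definition rule : Type := ((nat * nat) * (nat * nat))%type.

Section Generators.
Context (T : Type) (x : nat -> nat -> nat -> T) (add mul : T -> T -> T) (m1 : T).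
Context (B h : nat) (d : nat -> nat) (Eu Ev : seq rule).

Let sub p q := add p (mul m1 q).

(* [x i a b] is the derivative a^a b^b of variable i, where variable 0 is the
   marker t, 1 is u, 2 is v and s >= 3 is x_s.  The carrier T is left open to
   get terms, their codes and their values from a single list. *)
Definition testgen (i : nat) (r : rule) : T :=
  mul (x 0 0 0) (mul (x i 0 0) (sub (x r.1.1 r.1.2 0) (x r.2.1 r.2.2 0))).

Definition gens : seq T :=
  [:: x 1 0 0; x 2 0 0; x 0 1 0; x 0 0 1;
      mul (x 0 0 0) (x 1 0 1); mul (x 0 0 0) (x 2 1 0);
      mul (x 0 0 0) (x h 0 0)]%N ++
  [seq x s 0 0 | s <- iota 3 (B - 3)]%N ++
  [seq mul (x 0 0 0) (sub (x s 0 1) (x s (d s) 0)) | s <- iota 3 (B - 3)]%N ++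
  [seq testgen 1 r | r <- Eu] ++ [seq testgen 2 r | r <- Ev].

Definition goal (s N : nat) : T :=
  mul (x 0 0 0) (mul (x 1 0 0) (mul (x 2 0 0) (x s N 0))).

Definition bounded_rules (E : seq rule) :=
  all (fun r => [&& 2 < r.1.1, r.1.1 < B, 2 < r.2.1 & r.2.1 < B]%N) E.

End Generators.

(** Serves for two maps, the evaluation of terms and their Goedel numbering. The bound on [i] is
    there because [inord] keeps an index only below the number of variables. *)
Lemma gens_morph (T T' : Type) (f : T -> T') x x' add add' mul mul' m1 m1'
    B h d Eu Ev :
  (forall p q, f (add p q) = add' (f p) (f q)) ->
  (forall p q, f (mul p q) = mul' (f p) (f q)) -> f m1 = m1' ->
  (forall i a b, (i < B)%N -> f (x i a b) = x' i a b) ->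
  (2 < B)%N -> (h < B)%N -> bounded_rules B Eu -> bounded_rules B Ev ->
  map f (gens x add mul m1 B h d Eu Ev) = gens x' add' mul' m1' B h d Eu Ev.
Proof.
move=> fadd fmul f1 fx B2 hB bu bv.
have [B0 B1] : (0 < B)%N /\ (1 < B)%N by lia.
rewrite /gens !map_cat; congr (_ ++ (_ ++ (_ ++ (_ ++ _)))).
- by rewrite /= !fmul !fx.
- rewrite -map_comp; apply/eq_in_map => s; rewrite mem_iota /= => sB.
  by rewrite fx //; lia.
- rewrite -map_comp; apply/eq_in_map => s; rewrite mem_iota /= => sB.
  by rewrite !(fmul, fadd, fx) ?f1 //; lia.
- rewrite -map_comp; apply/eq_in_map => r /= /(allP bu) /and4P[_ ? _ ?].
  by rewrite /testgen !(fmul, fadd, fx) ?f1.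
- rewrite -map_comp; apply/eq_in_map => r /= /(allP bv) /and4P[_ ? _ ?].
  by rewrite /testgen !(fmul, fadd, fx) ?f1.
Qed.

Inductive reduces (h : nat) (d : nat -> nat) (Eu Ev : seq rule) :
  nat -> nat -> Prop :=
| reduces_halt N : reduces h d Eu Ev h N
| reduces_u r j of r \in Eu &
    reduces h d Eu Ev r.2.1 (r.2.2 + d r.2.1 * j) :
    reduces h d Eu Ev r.1.1 (r.1.2 + d r.1.1 * j)
| reduces_v r i of r \in Ev & reduces h d Eu Ev r.2.1 (r.2.2 + i) :
    reduces h d Eu Ev r.1.1 (r.1.2 + i).

(** * Reductions yield membership *)

Section Completeness.
Context (R : comNzRingType) (A : comAlgType R) (x : nat -> nat -> nat -> A).
Context (da db : A -> A).
Hypothesis (daB : forall p q, da (p - q) = da p - da q)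
  (dbB : forall p q, db (p - q) = db p - db q)
  (daM : forall p q, da (p * q) = da p * q + p * da q)
  (dbM : forall p q, db (p * q) = db p * q + p * db q)
  (dax : forall i a b, da (x i a b) = x i a.+1 b)
  (dbx : forall i a b, db (x i a b) = x i a b.+1).
Context (B h : nat) (d : nat -> nat) (Eu Ev : seq rule).
Hypothesis (B3 : (3 < B)%N) (hB : (2 < h < B)%N)
  (bu : bounded_rules B Eu) (bv : bounded_rules B Ev).
Context (P : A -> Prop).
Hypothesis (PZ : forall (a : R) p, P p -> P (a *: p))
  (PD : forall p q, P p -> P q -> P (p + q))
  (PM : forall p q, P p -> P q -> P (p * q))
  (Pa : forall p, P p -> P (da p)) (Pb : forall p, P p -> P (db p)).
Hypothesis Pgens : forall p,
  p \in gens x +%R *%R (-1) B h d Eu Ev -> P p.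

Let t := x 0 0 0.
Let u := x 1 0 0.
Let v := x 2 0 0.

Let PN p : P p -> P (- p).
Proof. by move=> Pp; rewrite -scaleN1r; apply: PZ. Qed.

Let PB p q : P p -> P q -> P (p - q).
Proof. by move=> Pp Pq; apply: PD => //; apply: PN. Qed.

(* Plays the role of membership in the differential ideal. *)
Definition tideal p := P p /\ P (t * p).

Lemma tidealM q p : P q -> tideal p -> tideal (q * p).
Proof. by move=> Pq [Pp Ptp]; split; [apply: PM|rewrite mulrCA; apply: PM]. Qed.

Lemma tidealD p q : tideal p -> tideal q -> tideal (p + q).
Proof.
by move=> [? ?] [? ?]; split; [apply: PD|rewrite mulrDr; apply: PD].
Qed.

Lemma tidealN p : tideal p -> tideal (- p).
Proof. by move=> [? ?]; split; [apply: PN|rewrite mulrN; apply: PN]. Qed.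

Lemma tidealB p q : tideal p -> tideal q -> tideal (p - q).
Proof. by move=> ? ?; apply: tidealD => //; apply: tidealN. Qed.

Lemma tideal_shift p q : tideal (p - q) -> tideal q -> tideal p.
Proof. by move=> Jpq Jq; rewrite -(subrK q p); apply: tidealD. Qed.

Let Pbase : P u /\ P v /\ P (da t) /\ P (db t).
Proof. by rewrite dax dbx; repeat split; apply: Pgens; rewrite mem_cat !inE eqxx ?orbT. Qed.

(** The marker pays off here: [da t] lies in [P] although [t] need not, so the Leibniz rule recovers
    [t * da p] from [da (t * p)]. *)
Lemma tideal_da p : tideal p -> tideal (da p).
Proof.
case: Pbase => _ [_ [Pt _]] [Pp Ptp]; split; first exact: Pa.
have -> : t * da p = da (t * p) - da t * p by rewrite daM addrC addKr.
by apply: PB; [apply: Pa|apply: PM].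
Qed.

Lemma tideal_db p : tideal p -> tideal (db p).
Proof.
case: Pbase => _ [_ [_ Pt]] [Pp Ptp]; split; first exact: Pb.
have -> : t * db p = db (t * p) - db t * p by rewrite dbM addrC addKr.
by apply: PB; [apply: Pb|apply: PM].
Qed.

Let Pstate s a b : (2 < s < B)%N -> P (x s a b).
Proof.
move=> sB; elim: b => [|b IH]; last by rewrite -dbx; apply: Pb.
elim: a => [|a IH]; last by rewrite -dax; apply: Pa.
apply: Pgens; rewrite !mem_cat; apply/orP; right; apply/orP; left.
by apply: (map_f (fun s => x s 0 0)); rewrite mem_iota; lia.
Qed.

Let Pgen_lin s : (2 < s < B)%N -> tideal (x s 0 1 - x s (d s) 0).
Proof.
move=> sB; split; first by apply: PB; apply: Pstate.
apply: Pgens; rewrite !mem_cat; do 2![apply/orP; right]; apply/orP; left.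
apply/mapP; exists s; first by rewrite mem_iota; lia.
by rewrite mulN1r.
Qed.

Lemma tideal_lin s i j : (2 < s < B)%N ->
  tideal (x s i j - x s (i + d s * j) 0).
Proof.
move=> sB; elim: j i => [|j IH] i.
  rewrite muln0 addn0 subrr; split; rewrite ?mulr0 -(subrr u);
  by apply: PB; case: Pbase.
(* The linear generator of [s] is differentiated [j] times by [db], then [i] times by [da]. *)
have step : tideal (x s i j.+1 - x s (i + d s) j).
  elim: i => [|i IHi].
    elim: j {IH} => [|j IHj]; first exact: Pgen_lin.
    by have := tideal_db IHj; rewrite dbB !dbx.
  by have := tideal_da IHi; rewrite daB !dax.
by have := tidealD step (IH (i + d s)%N); rewrite addrA subrK mulnS addnA.
Qed.

Let tideal_dbu : tideal (x 1 0 1).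
Proof.
split; first by rewrite -dbx; apply: Pb; case: Pbase.
by apply: Pgens; rewrite mem_cat !inE eqxx !orbT.
Qed.

Let tideal_dav : tideal (x 2 1 0).
Proof.
split; first by rewrite -dax; apply: Pa; case: Pbase => _ [].
by apply: Pgens; rewrite mem_cat !inE eqxx !orbT.
Qed.

Let Prule E r : bounded_rules B E -> r \in E ->
  [/\ (2 < r.1.1 < B)%N, (2 < r.2.1 < B)%N &
      forall a b, P (x r.1.1 a b) /\ P (x r.2.1 a b)].
Proof.
move=> bE /(allP bE)/and4P[r1 r2 r3 r4].
by rewrite r1 r2 r3 r4; split=> // a b; split; apply: Pstate; rewrite ?r1 ?r3.
Qed.

(** Differentiating by [db] leaves one unwanted Leibniz term, a multiple of [x 1 0 1], which is
    itself in [tideal]. The derivative of [u] by [da] has no such relation. *)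
Lemma tideal_u r j : r \in Eu ->
  tideal (u * (x r.1.1 r.1.2 j - x r.2.1 r.2.2 j)).
Proof.
move=> rE; have [_ _ Pr] := Prule bu rE; have [Pu _] := Pbase.
elim: j => [|j IH].
  split; first by apply: PM => //; apply: PB; case: (Pr r.1.2 0%N);
    case: (Pr r.2.2 0%N).
  apply: Pgens; rewrite !mem_cat; do 3![apply/orP; right]; apply/orP; left.
  by apply/mapP; exists r; rewrite // /testgen mulN1r.
have -> : u * (x r.1.1 r.1.2 j.+1 - x r.2.1 r.2.2 j.+1) =
    db (u * (x r.1.1 r.1.2 j - x r.2.1 r.2.2 j)) -
    (x r.1.1 r.1.2 j - x r.2.1 r.2.2 j) * x 1 0 1.
  by rewrite dbM dbB !dbx [_ * x 1 0 1]mulrC addrAC subrr add0r.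
apply: tidealB; first exact: tideal_db.
by apply: tidealM tideal_dbu; apply: PB; case: (Pr r.1.2 j); case: (Pr r.2.2 j).
Qed.

Lemma tideal_v r i : r \in Ev ->
  tideal (v * (x r.1.1 (r.1.2 + i) 0 - x r.2.1 (r.2.2 + i) 0)).
Proof.
move=> rE; have [_ _ Pr] := Prule bv rE; have [_ [Pv _]] := Pbase.
elim: i => [|i IH].
  rewrite !addn0; split.
    by apply: PM => //; apply: PB; case: (Pr r.1.2 0); case: (Pr r.2.2 0).
  apply: Pgens; rewrite !mem_cat; do 4![apply/orP; right].
  by apply/mapP; exists r; rewrite // /testgen mulN1r.
rewrite !addnS.
set y := _ - _ in IH; set z := x _ _ _ - _.
have -> : v * z = da (v * y) - y * x 2 1 0.
  by rewrite daM /y daB !dax [_ * x 2 1 0]mulrC addrAC subrr add0r.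
apply: tidealB; first exact: tideal_da.
apply: tidealM tideal_dav; rewrite /y.
by apply: PB; case: (Pr (r.1.2 + i) 0); case: (Pr (r.2.2 + i) 0).
Qed.

Definition conf s N := u * (v * x s N 0).

(** The rule holds for the mixed derivatives of order [j] in b. The linear relations then turn both
    sides into pure powers of a, each with the factor [d] of its own state; this discrepancy is the
    arithmetic. *)
Lemma tideal_conf_u r j : r \in Eu ->
  tideal (conf r.2.1 (r.2.2 + d r.2.1 * j)) ->
  tideal (conf r.1.1 (r.1.2 + d r.1.1 * j)).
Proof.
move=> rE; have [r1 r2 _] := Prule bu rE.
have [Pu [Pv _]] := Pbase; apply: tideal_shift.
have lin s e : (2 < s < B)%N -> tideal (u * (v * x s e j) - conf s (e + d s * j)).
  by move=> sB; rewrite -!mulrBr; do 2![apply: tidealM => //]; apply: tideal_lin.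
have := tidealM Pv (tideal_u j rE); rewrite mulrCA 2!mulrBr => test.
have := tidealB (tidealB test (lin _ r.1.2 r1)) (tidealN (lin _ r.2.2 r2)).
by congr tideal; ring.
Qed.

Lemma tideal_conf_v r i : r \in Ev ->
  tideal (conf r.2.1 (r.2.2 + i)) -> tideal (conf r.1.1 (r.1.2 + i)).
Proof.
move=> rE; apply: tideal_shift; rewrite -!mulrBr; apply: tidealM.
  by case: Pbase.
exact: tideal_v.
Qed.

Lemma tideal_conf_halt N : tideal (conf h N).
Proof.
have [Pu [Pv _]] := Pbase; do 2![apply: tidealM => //].
elim: N => [|N IH]; last by rewrite -dax; apply: tideal_da.
split; first exact: Pstate.
by apply: Pgens; rewrite mem_cat !inE eqxx !orbT.
Qed.

Lemma reduces_mem s N : reduces h d Eu Ev s N -> P (goal x *%R s N).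
Proof.
suff sub : reduces h d Eu Ev s N -> tideal (conf s N) by move=> /sub[].
elim=> {s N} [N|r j rE _|r i rE _]; first exact: tideal_conf_halt.
  exact: tideal_conf_u.
exact: tideal_conf_v.
Qed.

End Completeness.

(** * The separating functional *)

Section Soundness.
Context (R : comNzRingType) (A : comAlgType R) (m n : nat) (l0 l1 : 'I_m).
Hypothesis l01 : l0 != l1.
Local Notation X := (dvar m n.+1).
Implicit Types (k : {cmonom X}) (v : X).
Context (e : {cmonom X} -> A).
Hypothesis eM : forall k1 k2, e (mulcm k1 k2) = e k1 * e k2.
Hypothesis e_ind : forall P : A -> Prop, P 0 ->
  (forall p q, P p -> P q -> P (p + q)) -> (forall c k, P (c *: e k)) ->
  forall p, P p.
Context (D : 'I_m -> A -> A).
Hypothesis DD : forall l p q, D l (p + q) = D l p + D l q.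
Hypothesis DU : forall l c k, D l (c *: e k) = c *: dermon e (shiftv l) k.

Definition th (a b : nat) : m.-tuple nat :=
  [tuple (a * (j == l0) + b * (j == l1))%N | j < m].
Definition xvar (i a b : nat) : A := e (ucm ((inord i, th a b) : X)).

Context (T : nat -> nat -> R) (B h : nat) (d : nat -> nat) (Eu Ev : seq rule).
Hypothesis (hB : (2 < h < B)%N) (Bn : (B <= n.+1)%N)
  (bu : bounded_rules B Eu) (bv : bounded_rules B Ev).
Hypothesis Tu : forall r j, r \in Eu ->
  T r.1.1 (r.1.2 + d r.1.1 * j) = T r.2.1 (r.2.2 + d r.2.1 * j).
Hypothesis Tv : forall r i, r \in Ev ->
  T r.1.1 (r.1.2 + i) = T r.2.1 (r.2.2 + i).
Hypothesis Th : forall N, T h N = 0.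

Definition ord0v v : nat := tnth v.2 l0.
Definition ord1v v : nat := tnth v.2 l1.
Definition ordov v : nat := \sum_(j | (j != l0) && (j != l1)) tnth v.2 j.

Definition wvar (i : nat) v : nat := (v.1 == i :> nat).
Definition wst v : nat := (2 < v.1)%N.
(* Nonzero on the derivatives that the functional must kill: any of t, those
   of u by b, those of v by a, and all those by further derivations. *)
Definition wbad v : nat := (ordov v + wvar 0 v * (ord0v v + ord1v v) +
  wvar 1 v * ord1v v + wvar 2 v * ord0v v)%N.
Definition wsgn v : nat := (wvar 1 v * ord0v v + wvar 2 v * ord1v v)%N.
Definition walpha v : nat := ((wvar 1 v + wst v) * ord0v v)%N.
Definition wbeta v : nat := ((wvar 2 v + wst v) * ord1v v)%N.
(** On a multilinear monomial the total is the index of its only state variable. *)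
Definition wstate v : nat := (wst v * v.1)%N.

Definition multilinear k :=
  [&& wt (wvar 0) k == 1, wt (wvar 1) k == 1, wt (wvar 2) k == 1
    & wt wst k == 1]%N.

(* Integrating by parts moves the derivatives a^i of u and b^j of v onto x_s at
   the cost of the sign (-1)^(i + j); b then acts on x_s as a^(d s). *)
Definition value (bad sgn s a b : nat) : R :=
  if bad == 0%N then (-1) ^+ sgn * T s (a + d s * b) else 0.

Definition functional k : R :=
  if multilinear k then
    value (wt wbad k) (wt wsgn k) (wt wstate k) (wt walpha k) (wt wbeta k)
  else 0.

Lemma ord0_shift l v : ord0v (shiftv l v) = (ord0v v + (l == l0))%N.
Proof. by rewrite /ord0v tnth_mktuple eq_sym. Qed.

Lemma ord1_shift l v : ord1v (shiftv l v) = (ord1v v + (l == l1))%N.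
Proof. by rewrite /ord1v tnth_mktuple eq_sym. Qed.

Lemma ordo_shift l v :
  ordov (shiftv l v) = (ordov v + ((l != l0) && (l != l1)))%N.
Proof.
rewrite /ordov (eq_bigr (fun j => tnth v.2 j + (j == l))%N); last first.
  by move=> j _; rewrite tnth_mktuple.
rewrite big_split /=; congr addn; rewrite big_mkcond (bigD1 l) //= eqxx.
by rewrite big1 ?addn0 => [|j /negPf ->]; do ?case: ifP.
Qed.

Lemma wvar_shift i l v : wvar i (shiftv l v) = wvar i v. Proof. by []. Qed.

Lemma wst_shift l v : wst (shiftv l v) = wst v. Proof. by []. Qed.

Lemma wstate_shift l v : wstate (shiftv l v) = wstate v. Proof. by []. Qed.

Definition shiftE :=
  (ord0_shift, ord1_shift, ordo_shift, wvar_shift, wst_shift, wstate_shift).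

Definition subst_shift l k v : {cmonom X} :=
  mulcm (divcm k (ucm v)) (ucm (shiftv l v)).

Lemma functional_subst l k v cb cs ca cc : v \in finsupp k ->
  wbad (shiftv l v) = (wbad v + cb)%N -> wsgn (shiftv l v) = (wsgn v + cs)%N ->
  walpha (shiftv l v) = (walpha v + ca)%N ->
  wbeta (shiftv l v) = (wbeta v + cc)%N ->
  functional (subst_shift l k v) = if multilinear k then
    value (wt wbad k + cb) (wt wsgn k + cs) (wt wstate k)
      (wt walpha k + ca) (wt wbeta k + cc) else 0.
Proof.
move=> kv hb hs ha hc; rewrite /functional /multilinear.
have same w : w (shiftv l v) = w v -> wt w (subst_shift l k v) = wt w k.
  by move=> ww; rewrite (@wt_subst _ w _ _ _ 0) ?addn0.
rewrite (same (wvar 0)) // (same (wvar 1)) // (same (wvar 2)) // (same wst) //.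
rewrite (same wstate) // (wt_subst kv hb) (wt_subst kv hs).
by rewrite (wt_subst kv ha) (wt_subst kv hc).
Qed.

Lemma valueS bad sgn s a b : value bad sgn.+1 s a b = - value bad sgn s a b.
Proof.
by rewrite /value exprS; case: ifP; rewrite ?oppr0 // mulN1r mulNr.
Qed.

(* A derivation raises the order of x_s or of u (for a) or v (for b), with
   opposite signs; [j] is the index of u or v. *)
Lemma functional_shift l k : exists (j : nat) (G : R), ((j == 1) || (j == 2))%N /\
  forall v, v \in finsupp k -> functional (subst_shift l k v) =
    ((wst v)%:R - (wvar j v)%:R) * if multilinear k then G else 0.
Proof.
have [l_0|nl0] := eqVneq l l0.
- have nl1 : (l0 == l1) = false by apply/negbTE.
  exists 1%N, (value (wt wbad k) (wt wsgn k) (wt wstate k)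
    (wt walpha k).+1 (wt wbeta k)); split=> // v kv.
  rewrite (@functional_subst _ _ _ (wvar 0 v + wvar 2 v) (wvar 1 v)
    (wvar 1 v + wst v) 0) //; do ?[
    by rewrite /wbad /wsgn /walpha /wbeta !shiftE ?l_0 ?eqxx ?nl1 /= ?addn0 ?muln0; ring].
  case: ifP => _; last by rewrite mulr0.
  rewrite /wvar /wst; case: (nat_of_ord v.1) => [|[|[|i]]] /=;
    rewrite ?(addn0, addn1, addnS) ?valueS ?subrr ?mul0r ?subr0 ?mul1r //.
  by rewrite sub0r mulN1r.
have [l_1|nl1] := eqVneq l l1.
- exists 2%N, (value (wt wbad k) (wt wsgn k) (wt wstate k)
    (wt walpha k) (wt wbeta k).+1); split=> // v kv.
  rewrite (@functional_subst _ _ _ (wvar 0 v + wvar 1 v) (wvar 2 v)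
    0 (wvar 2 v + wst v)) //; do ?[
    by rewrite /wbad /wsgn /walpha /wbeta !shiftE ?(negPf nl0) ?l_1
      ?eqxx ?(eq_sym l1) ?(negPf l01) /= ?andbF ?addn0 ?muln0; ring].
  case: ifP => _; last by rewrite mulr0.
  rewrite /wvar /wst; case: (nat_of_ord v.1) => [|[|[|i]]] /=;
    rewrite ?(addn0, addn1, addnS) ?valueS ?subrr ?mul0r ?subr0 ?mul1r //.
  by rewrite sub0r mulN1r.
(* Any further derivation makes [wbad] positive, so all values vanish. *)
exists 1%N, (0 : R); split=> // v kv; rewrite (@functional_subst _ _ _ 1 0 0 0) //;
  try by rewrite /wbad /wsgn /walpha /wbeta !shiftE ?(negPf nl0)
    ?(negPf nl1) /= ?addn0 ?muln0; ring.
by rewrite addn1 !if_same mulr0.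
Qed.

(** With multiplicities, the coefficients of [functional_shift] add up to the degree in the state
    variables minus the degree in u or v. Both are one on a multilinear monomial. *)
Lemma functional_der l k :
  \sum_(v <- finsupp k) (k v)%:R * functional (subst_shift l k v) = 0.
Proof.
have [j [G [j12 fE]]] := functional_shift l k.
rewrite (eq_big_seq (fun v => ((k v * wst v)%:R - (k v * wvar j v)%:R) *
  if multilinear k then G else 0)); last first.
  by move=> v kv; rewrite fE // mulrA mulrBr !natrM.
rewrite -mulr_suml sumrB -!natr_sum -!/(wt _ _).
case: ifP => [/and4P[_ /eqP k1 /eqP k2 /eqP kx]|_]; last by rewrite mulr0.
by case/orP: j12 => /eqP ->; rewrite kx ?k1 ?k2 subrr mul0r.
Qed.

Lemma xvar_val i : (i <= n)%N -> (inord i : 'I_n.+1) = i :> nat.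
Proof. by move=> ?; rewrite inordK. Qed.

Lemma ord0_th (i : 'I_n.+1) a b : ord0v (i, th a b) = a.
Proof. by rewrite /ord0v tnth_mktuple eqxx (negPf l01) muln1 muln0 addn0. Qed.

Lemma ord1_th (i : 'I_n.+1) a b : ord1v (i, th a b) = b.
Proof. by rewrite /ord1v tnth_mktuple eqxx eq_sym (negPf l01) muln1 muln0. Qed.

Lemma ordo_th (i : 'I_n.+1) a b : ordov (i, th a b) = 0%N.
Proof.
rewrite /ordov big1 // => j /andP[/negPf j0 /negPf j1].
by rewrite tnth_mktuple j0 j1 !muln0.
Qed.

Lemma weights_xvar s a b (y := (inord s, th a b) : X) : (s <= n)%N ->
  ((forall i, wvar i y = (s == i)%N) * (wst y = (2 < s)%N) *
  (wbad y = (s == 0) * (a + b) + (s == 1) * b + (s == 2) * a)%N *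
  (wsgn y = (s == 1) * a + (s == 2) * b)%N *
  (walpha y = ((s == 1) + (2 < s)) * a)%N *
  (wbeta y = ((s == 2) + (2 < s)) * b)%N * (wstate y = (2 < s) * s)%N)%type.
Proof.
move=> sn; have ey : nat_of_ord y.1 = s := xvar_val sn.
rewrite /wbad /wsgn /walpha /wbeta /wstate /wst /wvar.
by rewrite ord0_th ord1_th ordo_th ey.
Qed.

Lemma functional_state k s a b : (2 < s <= n)%N ->
  functional (mulcm k (ucm (inord s, th a b))) =
  if [&& wt (wvar 0) k == 1, wt (wvar 1) k == 1, wt (wvar 2) k == 1
       & wt wst k == 0]%N
  then value (wt wbad k) (wt wsgn k) s (wt walpha k + a) (wt wbeta k + b)
  else 0.
Proof.
case/andP=> s2 sn; rewrite /functional /multilinear !wtM !wtU !weights_xvar //.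
have s012 : [&& s != 0, s != 1 & s != 2]%N by lia.
have [s0 s1 s2'] := and3P s012.
rewrite (negPf s0) (negPf s1) (negPf s2') s2 !mul0n !addn0 !mul1n addn1 eqSS.
case: ifP => // /and4P[_ _ _ /eqP k0].
(* The cofactor [k] contains no state variable, so the state index is [s] alone. *)
rewrite (@wt_eq0 _ wstate wst) // => v; rewrite /wstate => ->.
by rewrite mul0n.
Qed.

Lemma functional_bad k : (0 < wt wbad k)%N -> functional k = 0.
Proof.
by rewrite lt0n /functional /value => /negPf ->; rewrite if_same.
Qed.

Context (L : A -> R).
Hypothesis LD : forall p q, L (p + q) = L p + L q.
Hypothesis LU : forall c k, L (c *: e k) = c * functional k.
Hypothesis e1 : e (onecm X) = 1.

Lemma lin0 : L 0 = 0.
Proof. by apply: (addIr (L 0)); rewrite -LD !add0r. Qed.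

Lemma linZ c p : L (c *: p) = c * L p.
Proof.
elim/e_ind: p => [|p q IHp IHq|a k]; first by rewrite scaler0 lin0 mulr0.
  by rewrite scalerDr !LD IHp IHq mulrDr.
by rewrite scalerA !LU mulrA.
Qed.

Lemma linB p q : L (p - q) = L p - L q.
Proof. by rewrite LD -scaleN1r linZ mulN1r. Qed.

Lemma linE k : L (e k) = functional k.
Proof. by rewrite -[e k]scale1r LU mul1r. Qed.

Lemma lin_der l p : L (D l p) = 0.
Proof.
elim/e_ind: p => [|p q IHp IHq|c k].
- by rewrite (der0 (DD l)) lin0.
- by rewrite DD LD IHp IHq addr0.
rewrite DU linZ (big_morph L LD lin0).
rewrite (eq_bigr (fun v => (k v)%:R * functional (subst_shift l k v))).
  by rewrite functional_der mulr0.
by move=> v _; rewrite linZ linE.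
Qed.

(* The subalgebra lies in C + I, where C consists of the polynomials free of t
   and I is the largest ideal in the kernel of the functional, which is a
   differential ideal because the functional kills derivatives. *)
Inductive tfree : A -> Prop :=
| tfree0 : tfree 0
| tfreeD p q of tfree p & tfree q : tfree (p + q)
| tfreeU c k of wt (wvar 0) k = 0%N : tfree (c *: e k).

Lemma tfreeZ c p : tfree p -> tfree (c *: p).
Proof.
elim=> [|q r _ IHq _ IHr|a k k0]; first by rewrite scaler0; apply: tfree0.
  by rewrite scalerDr; apply: tfreeD.
by rewrite scalerA; apply: tfreeU.
Qed.

Lemma tfreeE k : wt (wvar 0) k = 0%N -> tfree (e k).
Proof. by rewrite -[e k]scale1r; apply: tfreeU. Qed.

Lemma tfreeM p q : tfree p -> tfree q -> tfree (p * q).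
Proof.
move=> tp tq; elim: tp => [|r r' _ IHr _ IHr'|a k k0].
- by rewrite mul0r; apply: tfree0.
- by rewrite mulrDl; apply: tfreeD.
rewrite -scalerAl; apply: tfreeZ.
elim: tq => [|r r' _ IHr _ IHr'|a' k' k'0].
- by rewrite mulr0; apply: tfree0.
- by rewrite mulrDr; apply: tfreeD.
by rewrite -scalerAr -eM; apply: tfreeU; rewrite wtM k0 k'0.
Qed.

Lemma tfree_der l p : tfree p -> tfree (D l p).
Proof.
elim=> [|q r _ IHq _ IHr|a k k0]; first by rewrite (der0 (DD l)); apply: tfree0.
  by rewrite DD; apply: tfreeD.
rewrite DU; apply: tfreeZ; rewrite /dermon big_seq.
apply: (big_ind tfree) => [|q r|v kv]; [exact: tfree0|exact: tfreeD|].
by apply: tfreeU; rewrite (@wt_subst _ _ _ _ _ 0) ?k0 ?addn0.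
Qed.

Lemma lin_tfree p : tfree p -> L p = 0.
Proof.
elim=> [|q r _ IHq _ IHr|a k k0]; first exact: lin0.
  by rewrite LD IHq IHr addr0.
by rewrite LU /functional /multilinear k0 mulr0.
Qed.

Definition annihilated p := forall q, L (q * p) = 0.

Lemma annihilatedE p : (forall k, L (e k * p) = 0) -> annihilated p.
Proof.
move=> kp; elim/e_ind => [|q r IHq IHr|c k]; first by rewrite mul0r lin0.
  by rewrite mulrDl LD IHq IHr addr0.
by rewrite -scalerAl linZ kp mulr0.
Qed.

Definition split_form p := exists2 c, tfree c & annihilated (p - c).

Lemma split_tfree p : tfree p -> split_form p.
Proof. by exists p => // q; rewrite subrr mulr0 lin0. Qed.

Lemma split_annihilated p : annihilated p -> split_form p.
Proof. by exists 0; [exact: tfree0|rewrite subr0]. Qed.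

Lemma split_formZ a p : split_form p -> split_form (a *: p).
Proof.
case=> c tc ac; exists (a *: c); first exact: tfreeZ.
by move=> q; rewrite -scalerBr -scalerAr linZ ac mulr0.
Qed.

Lemma split_formD p q : split_form p -> split_form q -> split_form (p + q).
Proof.
case=> c tc ac [c' tc' ac']; exists (c + c'); first exact: tfreeD.
by move=> r; rewrite opprD addrACA mulrDr LD ac ac' addr0.
Qed.

Lemma split_formM p q : split_form p -> split_form q -> split_form (p * q).
Proof.
case=> c tc ac [c' tc' ac']; exists (c * c'); first exact: tfreeM.
move=> r; have -> : r * (p * q - c * c') =
  r * q * (p - c) + r * c * (q - c') by ring.
by rewrite LD ac ac' addr0.
Qed.

Lemma split_form_der l p : split_form p -> split_form (D l p).
Proof.
case=> c tc ac; exists (D l c); first exact: tfree_der.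
have DB : D l p - D l c = D l (p - c).
  by rewrite DD (derN e_ind (DD l) (DU l)).
(* Integration by parts: [L] kills the derivative of [q * (p - c)], and also [D l q * (p - c)],
   hence the remaining term. *)
move=> q; rewrite DB; apply: (addrI (L (D l q * (p - c)))).
by rewrite -LD -(derM eM e_ind (DD l) (DU l)) lin_der ac addr0.
Qed.

(** Generators free of t are their own [tfree] part; all others are annihilated. Derivatives of t
    and the products with [x 1 0 1] or [x 2 1 0] are bad, t x_h falls to [Th], and each difference
    has two terms of equal value. *)
Lemma split_gens p :
  p \in gens xvar +%R *%R (-1) B h d Eu Ev -> split_form p.
Proof.
have n2 : (3 <= n)%N by lia.
have n1 : (1 <= n)%N by lia.
have n2' : (2 <= n)%N by lia.
have tfx i a b : (0 < i <= n)%N -> tfree (xvar i a b).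
  case/andP=> i0 i1; apply: tfreeE; rewrite wtU weights_xvar //.
  by rewrite (negPf (lt0n_neq0 i0)).
rewrite /gens !mem_cat => /or4P[|/mapP[s]|/mapP[s]|].
- rewrite !inE => /or4P[/eqP ->|/eqP ->|/eqP ->|].
  + by apply/split_tfree/tfx.
  + by apply/split_tfree/tfx.
  + apply/split_annihilated/annihilatedE => k; rewrite -eM linE functional_bad //.
    by rewrite wtM wtU weights_xvar //; lia.
  case/or4P=> /eqP ->; apply/split_annihilated/annihilatedE => k.
  + rewrite -eM linE functional_bad //.
    by rewrite wtM wtU weights_xvar //; lia.
  + rewrite -!eM linE functional_bad //.
    by rewrite !wtM !wtU !weights_xvar //; lia.
  + rewrite -!eM linE functional_bad //.
    by rewrite !wtM !wtU !weights_xvar //; lia.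
  rewrite mulrA -!eM linE functional_state; last by lia.
  by rewrite /value Th mulr0 !if_same.
- by rewrite mem_iota => sB ->; apply/split_tfree/tfx; lia.
- rewrite mem_iota => sB ->; apply/split_annihilated/annihilatedE => k.
  rewrite mulN1r mulrA mulrBr -!eM linB !linE !functional_state; try by lia.
  rewrite !addn0 addn1 /value mulnS addnA.
  by rewrite subrr.
case/orP=> /mapP[r rE ->].
- have /and4P[r1 r2 r3 r4] := allP bu r rE.
  apply/split_annihilated/annihilatedE => k.
  rewrite /testgen mulN1r !mulrA mulrBr -!eM linB !linE.
  rewrite !functional_state; try by lia.
  rewrite !addn0; case: ifP => [/and4P[_ k1 _ k0]|_]; last by rewrite subrr.
  set k' := mulcm _ _ in k1 k0 *.
  (* The undifferentiated u fills the only place for u, and no state variable is left, so a acts on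
     nothing in [k']. The values are then related by [Tu] with [j = wt wbeta k']. *)
  suff -> : wt walpha k' = 0%N by rewrite /value !add0n Tu // subrr.
  rewrite /k' !wtM !wtU; move: k1 k0; rewrite /k' !wtM !wtU.
  rewrite !weights_xvar //= !muln0 !addn0 addn1 eqSS.
  move=> /eqP k1 /eqP k0.
  apply: (@wt_eq0 _ _ (fun v => wvar 1 v + wst v)%N) => [v|] //;
    rewrite ?/walpha ?/wbeta; first by move=> ->.
  by rewrite wtD k1 k0.
have /and4P[r1 r2 r3 r4] := allP bv r rE.
apply/split_annihilated/annihilatedE => k.
rewrite /testgen mulN1r !mulrA mulrBr -!eM linB !linE.
rewrite !functional_state; try by lia.
rewrite !addn0; case: ifP => [/and4P[_ _ k1 k0]|_]; last by rewrite subrr.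
set k' := mulcm _ _ in k1 k0 *.
(* Symmetrically, v is undifferentiated, so b contributes nothing and [Tv] applies with
   [i = wt walpha k']. *)
suff -> : wt wbeta k' = 0%N.
  by rewrite /value !muln0 !addn0 [(_ + r.1.2)%N]addnC Tv // [(r.2.2 + _)%N]addnC subrr.
rewrite /k' !wtM !wtU; move: k1 k0; rewrite /k' !wtM !wtU.
rewrite !weights_xvar //= !muln0 !addn0 addn1 eqSS.
move=> /eqP k1 /eqP k0.
apply: (@wt_eq0 _ _ (fun v => wvar 2 v + wst v)%N) => [v|] //;
    rewrite ?/walpha ?/wbeta; first by move=> ->.
by rewrite wtD k1 k0.
Qed.

Lemma split_form1 : split_form 1.
Proof. by rewrite -e1; apply/split_tfree/tfreeE; rewrite wt1. Qed.

Lemma split_goal s N : (2 < s <= n)%N -> split_form (goal xvar *%R s N) ->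
  T s N = 0.
Proof.
move=> sn [c /lin_tfree Lc /(_ 1)]; rewrite mul1r linB Lc subr0.
have [n1 n2] : (1 <= n /\ 2 <= n)%N by lia.
rewrite /goal !mulrA -!eM linE functional_state // !wtM !wtU.
rewrite !weights_xvar //=.
by rewrite /value !muln0 /= !addn0 mul1r.
Qed.

Lemma separation s N : (2 < s <= n)%N ->
  (forall P : A -> Prop, P 1 -> (forall a p, P p -> P (a *: p)) ->
    (forall p q, P p -> P q -> P (p + q)) ->
    (forall p q, P p -> P q -> P (p * q)) ->
    (forall l p, P p -> P (D l p)) ->
    (forall p, p \in gens xvar +%R *%R (-1) B h d Eu Ev -> P p) ->
    P (goal xvar *%R s N)) ->
  T s N = 0.
Proof.
move=> sn /(_ split_form) H; apply: split_goal sn _; apply: H.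
- exact: split_form1.
- exact: split_formZ.
- exact: split_formD.
- exact: split_formM.
- exact: split_form_der.
exact: split_gens.
Qed.

End Soundness.

(** * Both directions for the concrete differential polynomial ring *)

Section Membership.
Context (R : comNzRingType) (m n : nat) (l0 l1 : 'I_m).
Hypothesis l01 : l0 != l1.
Context (B h : nat) (d : nat -> nat) (Eu Ev : seq rule).
Hypothesis (hB : (2 < h < B)%N) (Bn : (B <= n.+1)%N)
  (bu : bounded_rules B Eu) (bv : bounded_rules B Ev).

Definition tvar (i a b : nat) : dterm m n.+1 := TVar (inord i) (th l0 l1 a b).

Definition tgens : seq (dterm m n.+1) :=
  gens tvar (@TAdd _ _) (@TMul _ _) (TConst _ _ (Negz 0)) B h d Eu Ev.

Definition tgoal (s N : nat) : dterm m n.+1 := goal tvar (@TMul _ _) s N.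

Local Notation xv := (xvar l0 l1 (@emon R m n.+1)).

Lemma teval_tgens : map (@teval R m n.+1) tgens = gens xv +%R *%R (-1) B h d Eu Ev.
Proof. by apply: gens_morph => //; lia. Qed.

Lemma teval_tgoal s N : teval R (tgoal s N) = goal xv *%R s N.
Proof. by []. Qed.

Lemma th_shift0 a b (i : 'I_n.+1) :
  shiftv l0 (i, th l0 l1 a b) = (i, th l0 l1 a.+1 b).
Proof.
congr pair; apply: eq_from_tnth => j; rewrite !tnth_mktuple.
by case: (j == l0); lia.
Qed.

Lemma th_shift1 a b (i : 'I_n.+1) :
  shiftv l1 (i, th l0 l1 a b) = (i, th l0 l1 a b.+1).
Proof.
congr pair; apply: eq_from_tnth => j; rewrite !tnth_mktuple.
by case: (j == l1); lia.
Qed.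

Lemma der_var l v : der l (emon R (ucm v)) = emon R (ucm (shiftv l v) : {cmonom dvar m n.+1}).
Proof. by rewrite -[emon R (ucm v)]scale1r derU scale1r dermonU. Qed.

Lemma reduces_member s N : reduces h d Eu Ev s N ->
  in_dsubalg (map (@teval R m n.+1) tgens) (teval R (tgoal s N)).
Proof.
move=> sN; rewrite teval_tgens teval_tgoal; apply/in_dsubalg_alg.
move=> P P1 PZ PD PM Pder Pgens.
have dB l p q : der l (p - q) = der l p - der l q :> dpalg R m n.+1.
  by rewrite derD (derN (@emon_ind R m n.+1) (derD l) (derU l)).
have dM l := derM (@emonM R m n.+1) (@emon_ind R m n.+1) (derD l) (derU l).
have dx0 i a b : der l0 (xv i a b) = xv i a.+1 b by rewrite der_var th_shift0.
have dx1 i a b : der l1 (xv i a b) = xv i a b.+1 by rewrite der_var th_shift1.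
have B3 : (3 < B)%N by lia.
exact: (reduces_mem (dB l0) (dB l1) (dM l0) (dM l1) dx0 dx1 B3 hB bu bv PZ PD PM
  (Pder l0) (Pder l1) Pgens sN).
Qed.

Lemma member_vanish (T : nat -> nat -> R) s N :
  (forall r j, r \in Eu ->
    T r.1.1 (r.1.2 + d r.1.1 * j)%N = T r.2.1 (r.2.2 + d r.2.1 * j)%N) ->
  (forall r i, r \in Ev ->
    T r.1.1 (r.1.2 + i)%N = T r.2.1 (r.2.2 + i)%N) ->
  (forall M, T h M = 0) -> (2 < s <= n)%N ->
  in_dsubalg (map (@teval R m n.+1) tgens) (teval R (tgoal s N)) -> T s N = 0.
Proof.
move=> Tu Tv Th sn; rewrite teval_tgens teval_tgoal => /in_dsubalg_alg.
exact: (separation l01 (@emonM R m n.+1) (@emon_ind R m n.+1) (@derD R m n.+1)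
  (@derU R m n.+1) hB Bn bu bv Tu Tv Th
  (linextD (functional l0 l1 T d)) (linextU (functional l0 l1 T d)) erefl sn).
Qed.

End Membership.

Local Close Scope ring_scope.
Local Close Scope fset.

(** * Register machines as rewriting rules *)

(** Euclid's construction: a strictly increasing sequence of primes, which skips some (2, 3, 7,
    ...). *)
Fixpoint nth_prime (r : nat) : nat :=
  if r is r'.+1 then pdiv (nth_prime r')`!.+1 else 2.

Lemma nth_prime_prime r : prime (nth_prime r).
Proof. by case: r => //= r; rewrite pdiv_prime // ltnS fact_gt0. Qed.

Lemma nth_primeS r : (nth_prime r < nth_prime r.+1)%N.
Proof.
rewrite ltnNge; apply/negP => le.
have: (nth_prime r.+1 %| (nth_prime r)`!.+1)%N := pdiv_dvd _.
rewrite -[X in (_ %| X)%N]addn1 dvdn_addr ?dvdn1.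
  by move/eqP => p1; have := nth_prime_prime r.+1; rewrite p1.
by rewrite dvdn_fact // prime_gt0 // nth_prime_prime.
Qed.

Lemma nth_prime_inj : injective nth_prime.
Proof. by apply: incn_inj; apply: leq_mono; apply: homo_ltn nth_primeS; apply: ltn_trans. Qed.

Definition decode (N : nat) : nat -> nat := fun r => logn (nth_prime r) N.

Lemma decode_mul r N : (0 < N)%N ->
  decode (nth_prime r * N) = upd (decode N) r (decode N r).+1.
Proof.
move=> N0; apply/funext => i; rewrite /decode /upd.
have p0 := prime_gt0 (nth_prime_prime r).
rewrite lognM // (logn_prime _ (nth_prime_prime r)) (inj_eq nth_prime_inj).
by rewrite eq_sym; case: eqVneq => [->|_]; rewrite ?add1n.
Qed.

Lemma decode_init c : decode (2 ^ c) = (init c).2.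
Proof.
apply/funext => r; rewrite /decode lognX (logn_prime _ (nth_prime_prime 0)).
by rewrite (inj_eq nth_prime_inj) /=; case: eqP => _; rewrite ?muln1 ?muln0.
Qed.

Lemma upd_id f r v : upd (upd f r v) r (f r) = f.
Proof. by apply/funext => i; rewrite /upd; case: eqVneq => [->|]. Qed.

Lemma upd_same f r v : upd f r v r = v.
Proof. by rewrite /upd eqxx. Qed.

Section Simulation.
Context (prog : seq instr).
Local Notation sz := (size prog).

Definition halts (c : config) := exists k, (sz <= (run prog k c).1)%N.

Lemma run_halted k c : (sz <= c.1)%N -> run prog k c = c.
Proof.
move=> hc; elim: k => //= k ->; case: c hc => pc f /= hpc.
by rewrite /step ltnNge hpc; case: nth.
Qed.

Lemma halts_step c : halts (step prog c) <-> halts c.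
Proof.
split=> [[k hk]|[[|k] hk]]; first by exists k.+1; rewrite /run iterSr.
  have := run_halted 1 hk; rewrite /run /= => e.
  by exists 0%N; rewrite /run /= e.
by exists k; move: hk; rewrite /run iterSr.
Qed.

(* X is the state at instruction q; Y and Z are intermediate states in which b
   acts by a different power of a. *)
Definition stX (q : nat) : nat := (3 * q + 3)%N.
Definition stY (q : nat) : nat := (3 * q + 4)%N.
Definition stZ (q : nat) : nat := (3 * q + 5)%N.

(** For [INC], b acts as a on X and as a^p on Y, so [j] becomes [p * j]. For [JZDEC] the powers are
    exchanged: multiples of p are divided by p into Y, while a number with nonzero residue [e]
    passes unchanged to Z, where b also acts as a^p. *)
Definition rules_u (q : nat) : seq rule :=
  match nth (INC 0) prog q with
  | INC r => [:: ((stX q, 0), (stY q, 0))]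
  | JZDEC r j => ((stX q, 0), (stY q, 0)) ::
      [seq ((stX q, e), (stZ q, e)) | e <- iota 1 (nth_prime r).-1]
  end%N.

(** These rules keep the number and only lead from Y or Z to the next instruction. Jumps beyond the
    end are truncated to [sz], the halting state. *)
Definition rules_v (q : nat) : seq rule :=
  match nth (INC 0) prog q with
  | INC r => [:: ((stY q, 0), (stX q.+1, 0))]
  | JZDEC r j => [:: ((stY q, 0), (stX q.+1, 0)); ((stZ q, 0), (stX (minn j sz), 0))]
  end%N.

Definition prog_u : seq rule := flatten [seq rules_u q | q <- iota 0 sz].
Definition prog_v : seq rule := flatten [seq rules_v q | q <- iota 0 sz].

Definition jump (q : nat) : nat :=
  if nth (INC 0) prog q is JZDEC _ j then minn j sz else 0.

(** Inverts the numbering of states. The halting state reads the default [INC 0] and gets exponent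
    1. *)
Definition exponent (s : nat) : nat :=
  let q := (s - 3) %/ 3 in let y := (s - 3) %% 3 == 1 in
  match nth (INC 0) prog q with
  | INC r => if y then nth_prime r else 1
  | JZDEC r _ => if y then 1 else nth_prime r
  end%N.

Lemma st_divmod q : ((stX q - 3) %/ 3 = q) * ((stX q - 3) %% 3 = 0) *
  ((stY q - 3) %/ 3 = q) * ((stY q - 3) %% 3 = 1) *
  ((stZ q - 3) %/ 3 = q) * ((stZ q - 3) %% 3 = 2).
Proof. by rewrite /stX /stY /stZ; do !split; lia. Qed.

Lemma bounded_u : bounded_rules (stX sz).+1 prog_u.
Proof.
apply/allP => e /flattenP[s /mapP[q + ->]]; rewrite mem_iota => qs.
rewrite /rules_u; case: nth => [r|r j].
  by rewrite inE => /eqP -> /=; rewrite /stX /stY; lia.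
rewrite inE => /orP[/eqP ->|/mapP[i _ ->]] /=; rewrite /stX /stY /stZ; lia.
Qed.

Lemma bounded_v : bounded_rules (stX sz).+1 prog_v.
Proof.
apply/allP => e /flattenP[s /mapP[q + ->]]; rewrite mem_iota => qs.
rewrite /rules_v; case: nth => [r|r j].
  by rewrite inE => /eqP -> /=; rewrite /stX /stY; lia.
by rewrite !inE => /orP[/eqP ->|/eqP ->] /=; rewrite /stX /stY /stZ; lia.
Qed.

Section Step.
Context (q : nat) (qs : (q < sz)%N).

Lemma step_inc r N : nth (INC 0) prog q = INC r -> (0 < N)%N ->
  step prog (q, decode N) = (q.+1, decode (nth_prime r * N)).
Proof. by move=> eq N0; rewrite /step eq qs decode_mul. Qed.

Lemma step_dec r j N : nth (INC 0) prog q = JZDEC r j -> (0 < N)%N ->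
  step prog (q, decode (nth_prime r * N)) = (q.+1, decode N).
Proof.
by move=> eq N0; rewrite /step eq qs decode_mul // !upd_same /= upd_id.
Qed.

Lemma step_jump r j N : nth (INC 0) prog q = JZDEC r j ->
  ~~ (nth_prime r %| N)%N -> step prog (q, decode N) = (j, decode N).
Proof.
move=> eq rN; rewrite /step eq qs /decode; suff -> : logn (nth_prime r) N = 0%N by [].
by apply/eqP; rewrite -leqn0 leqNgt logn_gt0 mem_primes (negPf rN) !andbF.
Qed.

Lemma rules_u_mem r : r \in rules_u q -> r \in prog_u.
Proof.
by move=> rq; apply/flattenP; exists (rules_u q) => //; apply: map_f; rewrite mem_iota.
Qed.

Lemma rules_v_mem r : r \in rules_v q -> r \in prog_v.
Proof.
by move=> rq; apply/flattenP; exists (rules_v q) => //; apply: map_f; rewrite mem_iota.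
Qed.

End Step.

Local Notation red := (reduces (stX sz) exponent prog_u prog_v).

Lemma red_u s e s' e' j N N' : ((s, e), (s', e')) \in prog_u ->
  N = e + exponent s * j -> N' = e' + exponent s' * j -> red s' N' -> red s N.
Proof. by move=> rE -> ->; apply: (reduces_u rE). Qed.

Lemma red_v s e s' e' i N N' : ((s, e), (s', e')) \in prog_v ->
  N = e + i -> N' = e' + i -> red s' N' -> red s N.
Proof. by move=> rE -> ->; apply: (reduces_v rE). Qed.

(** Induction on the number of steps; each machine step is a rule of [prog_u] followed by one of
    [prog_v]. *)
Lemma halts_reduces q N : 0 < N -> halts (q, decode N) ->
  red (stX (minn q sz)) N.
Proof.
move=> N0 [k]; elim: k q N N0 => [|k IH] q N N0.
  by move=> /= /minn_idPr ->; apply: reduces_halt.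
have [qs|sq _] := ltnP q sz; last exact: reduces_halt.
rewrite /run iterSr -/(run _ _ _).
have mu := rules_u_mem qs; have mv := rules_v_mem qs.
case eq : (nth (INC 0) prog q) => [r|r j].
  have p0 := prime_gt0 (nth_prime_prime r).
  rewrite (step_inc qs eq N0) => /IH; rewrite muln_gt0 N0 p0 (minn_idPl qs).
  move=> /(_ isT) red1.
  apply: (@red_u _ 0 (stY q) 0 N _ (nth_prime r * N)).
  - by apply: mu; rewrite /rules_u eq inE.
  - by rewrite /exponent !st_divmod eq mul1n.
  - by rewrite /exponent !st_divmod eq.
  apply: (@red_v _ 0 _ 0 (nth_prime r * N) _ _ _ _ _ red1) => //.
  by apply: mv; rewrite /rules_v eq inE.
have p0 := prime_gt0 (nth_prime_prime r).
have [/dvdnP[M NM]|rN] := boolP (nth_prime r %| N).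
  have M0 : 0 < M by move: N0; rewrite NM muln_gt0 => /andP[].
  rewrite NM mulnC (step_dec qs eq M0) => /(IH _ _ M0); rewrite (minn_idPl qs).
  move=> red1; apply: (@red_u _ 0 (stY q) 0 M _ M).
  - by apply: mu; rewrite /rules_u eq inE eqxx.
  - by rewrite /exponent !st_divmod eq.
  - by rewrite /exponent !st_divmod eq mul1n.
  apply: (@red_v _ 0 _ 0 M _ _ _ _ _ red1) => //.
  by apply: mv; rewrite /rules_v eq inE eqxx.
rewrite (step_jump qs eq rN) => /(IH _ _ N0) red1.
(* The nonzero residue selects the rule, and the quotient is the order in b. *)
apply: (@red_u _ (N %% nth_prime r) (stZ q) (N %% nth_prime r) (N %/ nth_prime r) _ N).
- apply: mu; rewrite /rules_u eq inE; apply/orP; right.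
  apply: (map_f (fun e => ((stX q, e), (stZ q, e)))); rewrite mem_iota.
  by rewrite lt0n -/(_ %| _) rN add1n prednK // ltn_mod.
- by rewrite /exponent !st_divmod eq /= addnC mulnC -divn_eq.
- by rewrite /exponent !st_divmod eq /= addnC mulnC -divn_eq.
apply: (@red_v _ 0 _ 0 N _ _ _ _ _ red1) => //.
by apply: mv; rewrite /rules_v eq !inE eqxx orbT.
Qed.

Context (R : comNzRingType).

(** [N = 0] codes no configuration, yet the rules with offset 0 reach it at [j = 0]; the common
    value 0 there keeps them valid. *)
Definition nonhalting (q N : nat) : R :=
  if (0 < N) && ~~ `[< halts (q, decode N) >] then 1%R else 0%R.

(** Y and Z take the value of the instruction to which [rules_v] sends them. *)
Definition separator (s N : nat) : R :=
  let q := ((s - 3) %/ 3)%N in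
  match ((s - 3) %% 3)%N with
  | 0 => nonhalting q N
  | 1 => nonhalting q.+1 N
  | _ => nonhalting (jump q) N
  end.

Lemma separatorE q N :
  (separator (stX q) N = nonhalting q N) *
  (separator (stY q) N = nonhalting q.+1 N) *
  (separator (stZ q) N = nonhalting (jump q) N).
Proof. by rewrite /separator !st_divmod. Qed.

Lemma nonhalting_step q N q' N' :
  step prog (q, decode N) = (q', decode N') -> (0 < N) = (0 < N') ->
  nonhalting q N = nonhalting q' N'.
Proof.
move=> e N0; rewrite /nonhalting N0 -e.
by rewrite (asbool_equiv_eq (halts_step (q, decode N))).
Qed.

Lemma nonhalting_min q N : nonhalting (minn q sz) N = nonhalting q N.
Proof.
have [//|sq] := ltnP q sz; rewrite /nonhalting.
by congr (if _ && ~~ _ then _ else _); apply: asbool_equiv_eq; split=> _; exists 0.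
Qed.

Lemma separator_halt N : separator (stX sz) N = 0%R.
Proof.
rewrite separatorE /nonhalting; case: asboolP => [_|[]]; first by rewrite andbF.
by exists 0 => /=.
Qed.

Lemma separator_u r j : r \in prog_u ->
  separator r.1.1 (r.1.2 + exponent r.1.1 * j) =
  separator r.2.1 (r.2.2 + exponent r.2.1 * j).
Proof.
case/flattenP=> s /mapP[q + ->]; rewrite mem_iota add0n => /= qs.
rewrite /rules_u; case eq : (nth (INC 0) prog q) => [i|i l].
  have p0 := prime_gt0 (nth_prime_prime i).
  rewrite inE => /eqP -> /=; rewrite !separatorE /exponent !st_divmod eq /=.
  rewrite !add0n mul1n; case: (posnP j) => [->|j0]; first by rewrite muln0.
  by apply: nonhalting_step; rewrite ?muln_gt0 ?p0 // (step_inc qs eq j0).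
have p0 := prime_gt0 (nth_prime_prime i).
rewrite inE => /orP[/eqP -> /=|/mapP[e + -> /=]].
  rewrite !separatorE /exponent !st_divmod eq /=.
  rewrite !add0n mul1n; case: (posnP j) => [->|j0]; first by rewrite muln0.
  by apply: nonhalting_step; rewrite ?muln_gt0 ?p0 // (step_dec qs eq j0).
rewrite mem_iota add1n prednK // => /andP[e0 ep].
rewrite !separatorE /exponent !st_divmod eq /= /jump eq nonhalting_min.
apply: nonhalting_step => //; apply: step_jump qs _ _ _ eq _.
by rewrite addnC dvdn_addr ?dvdn_mulr // gtnNdvd.
Qed.

Lemma separator_v r i : r \in prog_v ->
  separator r.1.1 (r.1.2 + i) = separator r.2.1 (r.2.2 + i).
Proof.
case/flattenP=> s /mapP[q + ->]; rewrite mem_iota add0n => /= qs.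
rewrite /rules_v; case eq : (nth (INC 0) prog q) => [k|k l].
  by rewrite inE => /eqP -> /=; rewrite !separatorE.
by rewrite !inE => /orP[] /eqP -> /=; rewrite !separatorE // /jump eq.
Qed.

End Simulation.

(** * Compiling loop programs *)

Lemma run_add prog k l c : run prog (k + l) c = run prog k (run prog l c).
Proof. by rewrite /run iterD. Qed.

Lemma halts_run prog k c : halts prog (run prog k c) <-> halts prog c.
Proof. by elim: k => // k IH; rewrite /run iterS halts_step. Qed.

(* [CLoop r c] decrements register r before each execution of c.  Its
   denotation fixes the number of iterations in advance, hence [wf]. *)
Inductive cmd :=
| CSkip
| CInc of nat
| CSeq of cmd & cmd
| CLoop of nat & cmd.

Fixpoint den (c : cmd) (s : seq nat) : seq nat :=
  match c with
  | CSkip => s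
  | CInc r => set_nth 0 s r (nth 0 s r).+1
  | CSeq c1 c2 => den c2 (den c1 s)
  | CLoop r c1 =>
      iter (nth 0 s r) (fun s' => den c1 (set_nth 0 s' r (nth 0 s' r).-1)) s
  end.

Fixpoint preserves (r : nat) (c : cmd) : bool :=
  match c with
  | CSkip => true
  | CInc q => q != r
  | CSeq c1 c2 => preserves r c1 && preserves r c2
  | CLoop q c1 => (q != r) && preserves r c1
  end.

Fixpoint wf (c : cmd) : bool :=
  match c with
  | CSeq c1 c2 => wf c1 && wf c2
  | CLoop r c1 => preserves r c1 && wf c1
  | _ => true
  end.

Lemma den_preserves r c s : preserves r c -> nth 0 (den c s) r = nth 0 s r.
Proof.
elim: c s => [|q|c1 IH1 c2 IH2|q c IH] s //=.
- by move=> qr; rewrite nth_set_nth /= eq_sym (negPf qr).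
- by case/andP=> p1 p2; rewrite IH2 // IH1.
case/andP=> qr pc; elim: (nth 0 s q) => //= k IHk.
by rewrite IH // nth_set_nth /= eq_sym (negPf qr).
Qed.

Lemma upd_nth (s : seq nat) r v : upd (nth 0 s) r v = nth 0 (set_nth 0 s r v).
Proof. by apply/funext => i; rewrite nth_set_nth. Qed.

Section Compile.
(* Register z stays 0, so that [JZDEC z] is an unconditional jump. *)
Context (z : nat).

Fixpoint compile (off : nat) (c : cmd) : seq instr :=
  match c with
  | CSkip => [::]
  | CInc r => [:: INC r]
  | CSeq c1 c2 =>
      let p := compile off c1 in p ++ compile (off + size p) c2
  | CLoop r c1 =>
      let p := compile off.+1 c1 in
      JZDEC r (off + (size p).+2) :: rcons p (JZDEC z off)
  end.

(** The surrounding code [p1] and [p2] is arbitrary because subcommands are compiled at inner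
    offsets. *)
Lemma compile_correct c p1 p2 s (prog := p1 ++ compile (size p1) c ++ p2) :
  wf c -> preserves z c -> nth 0 s z = 0 ->
  exists k, run prog k (size p1, nth 0 s) =
    (size p1 + size (compile (size p1) c), nth 0 (den c s)).
Proof.
rewrite {}/prog; elim: c p1 p2 s => [|r|c1 IH1 c2 IH2|r c IH] p1 p2 s /=.
- by exists 0; rewrite addn0.
- exists 1; rewrite /run /= /step nth_cat ltnn subnn /= size_cat /=.
  by rewrite -[X in (X < _)%N]addn0 ltn_add2l /= upd_nth addn1.
- case/andP=> w1 w2 /andP[z1 z2] s0.
  have [k1 e1] := IH1 p1 (compile (size p1 + size (compile (size p1) c1)) c2 ++ p2) s w1 z1 s0.
  have s1 : nth 0 (den c1 s) z = 0 by rewrite den_preserves.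
  have [k2 e2] := IH2 (p1 ++ compile (size p1) c1) p2 (den c1 s) w2 z2 s1.
  exists (k2 + k1); rewrite run_add -catA e1.
  by rewrite size_cat -catA in e2; rewrite e2 size_cat addnA.
case/andP=> rc wc /andP[rz zc] s0.
set body := compile (size p1).+1 c; set prog := p1 ++ _.
have progE : prog = rcons p1 (JZDEC r (size p1 + (size body).+2)) ++
    body ++ (JZDEC z (size p1) :: p2).
  by rewrite /prog cat_rcons /= -cats1 -catA.
have at0 : nth (INC 0) prog (size p1) = JZDEC r (size p1 + (size body).+2).
  by rewrite /prog nth_cat ltnn subnn.
have at1 : nth (INC 0) prog (size p1 + (size body).+1) = JZDEC z (size p1).
  rewrite progE catA nth_cat size_cat size_rcons addSnnS ltnn.
  by rewrite subnn.
have sz : size prog = size p1 + (size body).+2 + size p2.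
  by rewrite progE !size_cat size_rcons /=; lia.
rewrite size_rcons.
have [j sj] : exists j, nth 0 s r = j by exists (nth 0 s r).
rewrite sj; elim: j s s0 sj => [|j IHj] s s0 sj.
  by exists 1; rewrite /run /= /step at0 sz sj; case: ifP => //; lia.
set s1 := set_nth 0 s r j.
have s10 : nth 0 s1 z = 0 by rewrite nth_set_nth /= eq_sym (negPf rz).
have [k1 e1] := IH (rcons p1 (JZDEC r (size p1 + (size body).+2)))
  (JZDEC z (size p1) :: p2) s1 wc zc s10.
rewrite size_rcons -/body -progE in e1.
have s20 : nth 0 (den c s1) z = 0 by rewrite den_preserves.
have s2j : nth 0 (den c s1) r = j.
  by rewrite den_preserves // nth_set_nth /= eqxx.
have [k2 e2] := IHj (den c s1) s20 s2j.
(* Read from the right: decrement, body, jump back, remaining iterations. *)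
exists (k2 + (1 + (k1 + 1))); rewrite !run_add.
have -> : run prog 1 (size p1, nth 0 s) = ((size p1).+1, nth 0 s1).
  by rewrite /run /= /step at0 sz sj upd_nth; case: ifP => //; lia.
rewrite e1 addSnnS.
have -> : run prog 1 (size p1 + (size body).+1, nth 0 (den c s1)) =
    (size p1, nth 0 (den c s1)).
  by rewrite /run /= /step at1 sz s20; case: ifP => //; lia.
by rewrite e2 iterSr sj.
Qed.

End Compile.

(** * Loop programs for pairing, powers of two and codes *)

Definition incs (rs : seq nat) : cmd := foldr (fun r => CSeq (CInc r)) CSkip rs.
Definition move (r : nat) (rs : seq nat) : cmd := CLoop r (incs rs).
Definition seqs (cs : seq cmd) : cmd := foldr CSeq CSkip cs.

(* Register 4 counts the iterations, so that register 2 accumulates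
   b + (1 + ... + (a + b)). *)
Definition pair01 : cmd := seqs
  [:: move 1 [:: 0; 2];
      CLoop 0 (seqs [:: CInc 4; move 4 [:: 2; 3]; move 3 [:: 4]]);
      move 4 [::]; move 2 [:: 0]].

Definition lpair (k : nat) : cmd :=
  seqs [:: move 0 [:: 1]; incs (nseq k 0); pair01].

(** The outer layer of [enc_term], where the residue modulo 4 marks the constructor. *)
Definition tag (t : nat) : cmd :=
  seqs [:: move 0 (nseq 4 1); move 1 [:: 0]; incs (nseq t 0)].

(** Register 0 belongs to the prime 2, so [2 ^ c] codes the initial registers on input [c]. *)
Definition pow2 : cmd :=
  seqs [:: CInc 0; CLoop 6 (seqs [:: move 0 [:: 1; 1]; move 1 [:: 0]])].

Lemma den_seqs_cons c cs s : den (seqs (c :: cs)) s = den (seqs cs) (den c s).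
Proof. by []. Qed.

Lemma den_seqs_nil s : den (seqs [::]) s = s.
Proof. by []. Qed.

Lemma den_incs0 k x t : den (incs (nseq k 0)) (x :: t) = x + k :: t.
Proof. by elim: k x => [|k IH] x /=; rewrite ?addn0 // IH addnS. Qed.

Lemma den_incs1 k x y t : den (incs (nseq k 1)) (x :: y :: t) = x :: y + k :: t.
Proof. by elim: k y => [|k IH] y /=; rewrite ?addn0 // IH addnS. Qed.

Section Moves.
Context (x0 x1 x2 x3 x4 x5 x6 : nat).

Lemma den_move01 : den (move 0 [:: 1]) [:: x0; x1; x2; x3; x4; x5; x6] =
  [:: 0; x1 + x0; x2; x3; x4; x5; x6].
Proof.
by rewrite /=; elim: x0 x1 => [|n IH] y; rewrite ?addn0 // iterSr /= IH !addSnnS.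
Qed.

Lemma den_move0k k : den (move 0 (nseq k 1)) [:: x0; x1; x2; x3; x4; x5; x6] =
  [:: 0; x1 + k * x0; x2; x3; x4; x5; x6].
Proof.
rewrite /=; elim: x0 x1 => [|n IHn] y; first by rewrite muln0 addn0.
by rewrite iterSr /= den_incs1 IHn mulnS addnA.
Qed.

Lemma den_move10 : den (move 1 [:: 0]) [:: x0; x1; x2; x3; x4; x5; x6] =
  [:: x0 + x1; 0; x2; x3; x4; x5; x6].
Proof.
by rewrite /=; elim: x1 x0 => [|n IH] y; rewrite ?addn0 // iterSr /= IH !addSnnS.
Qed.

Lemma den_move102 : den (move 1 [:: 0; 2]) [:: x0; x1; x2; x3; x4; x5; x6] =
  [:: x0 + x1; 0; x2 + x1; x3; x4; x5; x6].
Proof.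
by rewrite /=; elim: x1 x0 x2 => [|n IH] y z; rewrite ?addn0 // iterSr /= IH !addSnnS.
Qed.

Lemma den_move423 : den (move 4 [:: 2; 3]) [:: x0; x1; x2; x3; x4; x5; x6] =
  [:: x0; x1; x2 + x4; x3 + x4; 0; x5; x6].
Proof.
by rewrite /=; elim: x4 x2 x3 => [|n IH] y z; rewrite ?addn0 // iterSr /= IH !addSnnS.
Qed.

Lemma den_move34 : den (move 3 [:: 4]) [:: x0; x1; x2; x3; x4; x5; x6] =
  [:: x0; x1; x2; 0; x4 + x3; x5; x6].
Proof.
by rewrite /=; elim: x3 x4 => [|n IH] y; rewrite ?addn0 // iterSr /= IH !addSnnS.
Qed.

Lemma den_move4 : den (move 4 [::]) [:: x0; x1; x2; x3; x4; x5; x6] =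
  [:: x0; x1; x2; x3; 0; x5; x6].
Proof.
by rewrite /=; elim: x4 => [|n IH]; rewrite ?addn0 // iterSr /= IH.
Qed.

Lemma den_move20 : den (move 2 [:: 0]) [:: x0; x1; x2; x3; x4; x5; x6] =
  [:: x0 + x2; x1; 0; x3; x4; x5; x6].
Proof.
by rewrite /=; elim: x2 x0 => [|n IH] y; rewrite ?addn0 // iterSr /= IH !addSnnS.
Qed.

Lemma den_move056 : den (move 0 [:: 5; 6]) [:: x0; x1; x2; x3; x4; x5; x6] =
  [:: 0; x1; x2; x3; x4; x5 + x0; x6 + x0].
Proof.
by rewrite /=; elim: x0 x5 x6 => [|n IH] y z; rewrite ?addn0 // iterSr /= IH !addSnnS.
Qed.

Lemma den_move516 : den (move 5 [:: 1; 6]) [:: x0; x1; x2; x3; x4; x5; x6] =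
  [:: x0; x1 + x5; x2; x3; x4; 0; x6 + x5].
Proof.
by rewrite /=; elim: x5 x1 x6 => [|n IH] y z; rewrite ?addn0 // iterSr /= IH !addSnnS.
Qed.

Lemma den_move60 : den (move 6 [:: 0]) [:: x0; x1; x2; x3; x4; x5; x6] =
  [:: x0 + x6; x1; x2; x3; x4; x5; 0].
Proof.
by rewrite /=; elim: x6 x0 => [|n IH] y; rewrite ?addn0 // iterSr /= IH !addSnnS.
Qed.

End Moves.

Section Programs.
Context (x5 x6 : nat).

Lemma den_pair01 a b : den pair01 [:: a; b; 0; 0; 0; x5; x6] =
  [:: cpair a b; 0; 0; 0; 0; x5; x6].
Proof.
rewrite /pair01 /seqs; cbn [foldr den]; rewrite den_move102 /nth.
set F := fun s' => _.
(* With [k] iterations done and [n] to go, register 2 still gains (k + 1) + ... + (k + n). *)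
have tri n k s : iter n F [:: n; 0; s; 0; k; x5; x6] =
    [:: 0; 0; s + n * k + (n * n.+1)./2; 0; k + n; x5; x6].
  elim: n k s => [|n IH] k s; first by rewrite !addn0.
  rewrite iterSr {2}/F; cbn [set_nth nth predn den].
  rewrite den_move423 den_move34 IH; do ?[congr (_ :: _)]; last lia.
  have -> : (n.+1 * n.+2)./2 = (n * n.+1)./2 + n.+1.
    have -> : n.+1 * n.+2 = n.+1.*2 + n * n.+1 by rewrite -muln2; ring.
    by rewrite halfD odd_double doubleK add0n addnC.
  by rewrite mulSn; lia.
rewrite tri den_move4 den_move20 /cpair !muln0 !addn0 !add0n.
by rewrite addnC.
Qed.

Lemma den_lpair k a : den (lpair k) [:: a; 0; 0; 0; 0; x5; x6] =
  [:: cpair k a; 0; 0; 0; 0; x5; x6].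
Proof.
rewrite /lpair /seqs; cbn [foldr den].
by rewrite den_move01 den_incs0 !add0n den_pair01.
Qed.

Lemma den_tag t a : den (tag t) [:: a; 0; 0; 0; 0; x5; x6] =
  [:: 4 * a + t; 0; 0; 0; 0; x5; x6].
Proof.
rewrite /tag /seqs; cbn [foldr den].
by rewrite den_move0k den_move10 den_incs0 !add0n.
Qed.

End Programs.

Lemma den_pow2 x5 k : den pow2 [:: 0; 0; 0; 0; 0; x5; k] =
  [:: 2 ^ k; 0; 0; 0; 0; x5; 0].
Proof.
rewrite /pow2 /seqs; cbn [foldr den set_nth nth].
set F := fun s' => _.
suff powF x : iter k F [:: x; 0; 0; 0; 0; x5; k] =
  [:: x * 2 ^ k; 0; 0; 0; 0; x5; 0] by rewrite powF mul1n.
elim: k x => [|k IH] x; first by rewrite muln1.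
rewrite iterSr {2}/F; cbn [set_nth nth predn].
by rewrite (den_move0k _ _ _ _ _ _ _ 2) den_move10 IH add0n expnS mulnCA mulnA.
Qed.

(* On input c, computes the code of the instance with generator code c. *)
Definition encoder (k0 k1 k2 K : nat) : cmd := seqs
  [:: move 0 [:: 5; 6]; pow2; incs (nseq K 1); pair01; incs (nseq 1 0);
      lpair 3; tag 1; lpair k2; tag 3; lpair k1; tag 3; lpair k0; tag 3;
      move 5 [:: 1; 6]; pair01;
      move 0 [:: 1]; move 6 [:: 0]; incs (nseq 1 0); pair01].

(** The layers mirror the code of [goal]: [k0], [k1], [k2] stand for t, u, v, the 3 is [stX 0], and
    [(cpair (2 ^ c) K).+1] is the exponent vector with first entry [2 ^ c] when [K] codes the other
    zeros. *)
Lemma den_encoder k0 k1 k2 K c :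
  den (encoder k0 k1 k2 K) [:: c; 0; 0; 0; 0; 0; 0] =
  [:: cpair c.+1 (cpair (4 * cpair k0 (4 * cpair k1 (4 * cpair k2
     (4 * cpair 3 (cpair (2 ^ c) K).+1 + 1) + 3) + 3) + 3) c);
     0; 0; 0; 0; 0; 0].
Proof.
rewrite /encoder.
rewrite den_seqs_cons den_move056 !add0n den_seqs_cons den_pow2.
rewrite den_seqs_cons den_incs1 add0n den_seqs_cons den_pair01.
rewrite den_seqs_cons den_incs0 addn1.
do 4![rewrite den_seqs_cons den_lpair den_seqs_cons den_tag].
rewrite den_seqs_cons den_move516 !add0n den_seqs_cons den_pair01.
rewrite den_seqs_cons den_move01 !add0n den_seqs_cons den_move60 add0n.
by rewrite den_seqs_cons den_incs0 addn1 den_seqs_cons den_pair01 den_seqs_nil.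
Qed.

Lemma preserves_incs r q k : q != r -> preserves r (incs (nseq k q)).
Proof. by move=> qr; elim: k => //= k ->; rewrite qr. Qed.

Lemma wf_incs rs : wf (incs rs).
Proof. by elim: rs. Qed.

Lemma encoder_wf k0 k1 k2 K : wf (encoder k0 k1 k2 K).
Proof. by rewrite /= !wf_incs. Qed.

Lemma encoder_preserves k0 k1 k2 K : preserves 7 (encoder k0 k1 k2 K).
Proof. by rewrite /= !preserves_incs. Qed.

(** * Diagonalization *)

Section Diagonal.
Context (dec : seq instr) (enc : cmd).
Hypothesis (enc_wf : wf enc) (enc7 : preserves 7 enc).

Let code := compile 7 0 enc.
Let off := size code.
Let fin := off + size dec.

(** Truncating the targets makes every halt of [dec] arrive at the same address [fin]. *)
Definition relocate (i : instr) : instr :=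
  if i is JZDEC r j then JZDEC r (off + minn j (size dec)) else i.

(* The tail runs forever if register 0 holds 1 and halts otherwise. *)
Definition diagonal : seq instr := code ++ map relocate dec ++
  [:: JZDEC 0 (fin + 4); JZDEC 0 (fin + 3); INC 0; JZDEC 0 (fin + 3)].

Let size_diag : size diagonal = fin + 4.
Proof. by rewrite !size_cat size_map addnA. Qed.

Lemma diagonal_dec k pc f : size dec <= (run dec k (pc, f)).1 ->
  exists k', run diagonal k' (off + minn pc (size dec), f) =
    (fin, (run dec k (pc, f)).2).
Proof.
elim: k pc f => [|k IH] pc f.
  by move=> /= /minn_idPr ->; exists 0.
have [sp|ps] := leqP (size dec) pc.
  by move=> _; exists 0; rewrite [run dec _ _]run_halted.
rewrite /run iterSr -/(run _ _ _).
have at_pc : nth (INC 0) diagonal (off + pc) = relocate (nth (INC 0) dec pc).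
  rewrite /diagonal nth_cat ltnNge leq_addr addKn nth_cat size_map ps.
  by rewrite (nth_map (INC 0)).
have stepE : step diagonal (off + pc, f) =
    (off + minn (step dec (pc, f)).1 (size dec), (step dec (pc, f)).2).
  rewrite /step at_pc size_diag ps ifT; last by rewrite /fin; lia.
  case: nth => [r|r j] /=; first by rewrite (minn_idPl ps) addnS.
  by case: ifP => //= _; rewrite (minn_idPl ps) addnS.
have := IH (step dec (pc, f)).1 (step dec (pc, f)).2.
rewrite -surjective_pairing => IHs /IHs[k' e].
by exists k'.+1; rewrite /run iterSr [step _ _]stepE.
Qed.

Lemma diagonal_tail f : halts diagonal (fin, f) <-> f 0 <> 1.
Proof.
have at_tail i : nth (INC 0) diagonal (fin + i) =
    nth (INC 0) [:: JZDEC 0 (fin + 4); JZDEC 0 (fin + 3); INC 0; JZDEC 0 (fin + 3)] i.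
  rewrite /diagonal catA nth_cat size_cat size_map -/fin ltnNge leq_addr /=.
  by rewrite addKn.
have lt_fin i : (fin + i < fin + 4) = (i < 4) by rewrite ltn_add2l.
have stepi i g : i < 4 -> step diagonal (fin + i, g) =
    match nth (INC 0) [:: JZDEC 0 (fin + 4); JZDEC 0 (fin + 3); INC 0;
      JZDEC 0 (fin + 3)] i with
    | INC r => (fin + i.+1, upd g r (g r).+1)
    | JZDEC r j => if g r == 0 then (j, g) else (fin + i.+1, upd g r (g r).-1)
    end.
  by move=> i4; rewrite /step at_tail size_diag lt_fin i4; case: nth => [r|r j]; rewrite addnS.
have halt4 g : halts diagonal (fin + 4, g) by exists 0; rewrite size_diag.
rewrite -[fin in (fin, _)]addn0 -halts_step stepi //=.
have [->|f0] := eqVneq (f 0) 0; first by split.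
rewrite -halts_step stepi //= upd_same.
have [f1|f1] := eqVneq (f 0).-1 0.
  (* Register 0 held 1 and is now 0, so control reaches the last instruction, which jumps to
     itself. *)
  split=> [[k]|]; last by lia.
  set g := upd _ _ _; suff -> : run diagonal k (fin + 3, g) = (fin + 3, g).
    by rewrite size_diag /=; lia.
  by elim: k => // k; rewrite /run iterS => ->; rewrite stepi //= /g upd_same f1.
split=> [_|_]; first by lia.
(* [INC 0] makes register 0 positive, so the last [JZDEC] falls through to the end. *)
rewrite -halts_step stepi // -halts_step stepi //= upd_same; exact: halt4.
Qed.

(** Encoder, decider and tail run in sequence; as the encoder clears all registers but 0, the
    decider starts from [init v]. *)
Lemma diagonal_correct c v y : den enc (c :: nseq 6 0) = v :: nseq 6 0 ->
  halts_with dec v y -> halts diagonal (init c) <-> y <> 1.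
Proof.
move=> encE [k [hk <-]].
have init_nth x : init x = (0, nth 0 (x :: nseq 6 0)).
  by congr pair; apply/funext => -[|[|[|[|[|[|[|[|]]]]]]]].
have [k1] := @compile_correct 7 enc [::] (map relocate dec ++
  [:: JZDEC 0 (fin + 4); JZDEC 0 (fin + 3); INC 0; JZDEC 0 (fin + 3)])
  (c :: nseq 6 0) enc_wf enc7 erefl.
rewrite cat0s -/code -/diagonal encE add0n -/off => e1.
rewrite !init_nth in hk *.
have [k2] := diagonal_dec hk; rewrite min0n addn0 => e2.
rewrite -(halts_run diagonal (k2 + k1)) run_add e1 e2.
exact: diagonal_tail.
Qed.

End Diagonal.

Lemma leq_cpair a b : a + b <= cpair a b.
Proof.
rewrite /cpair; suff : a + b <= ((a + b) * (a + b).+1)./2 by lia.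
case: (a + b) => // n; rewrite -[X in X <= _]doubleK.
by apply: half_leq; rewrite -muln2 leq_mul2l orbT.
Qed.

Lemma mem_enc_seq s i : i \in s -> i < enc_seq s.
Proof.
elim: s => //= j s IH; rewrite inE ltnS => /orP[/eqP ->|/IH] /=;
  have := leq_cpair j (enc_seq s); lia.
Qed.

(** * Halting instances and their codes *)

Section Instances.
Context (R : comNzRingType) (m : nat).
Local Notation M := m.+2.
Local Notation l0 := (@ord0 m.+1).
Local Notation l1 := (@Ordinal m.+2 1 isT).

Lemma enc_seq_th N : enc_seq (th l0 l1 N 0) =
  (cpair N (enc_seq (nseq m.+1 0))).+1.
Proof.
suff -> : th l0 l1 N 0 = N :: nseq m.+1 0 :> seq nat by [].
apply: (@eq_from_nth _ 0) => [|i]; rewrite size_tuple ?[size (_ :: _)]/= ?size_nseq // => iM.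
rewrite -(tnth_nth 0 _ (Ordinal iM)) tnth_mktuple mul0n addn0.
by case: i iM => [|i] iM; rewrite ?muln1 // muln0
  -[RHS]/(nth 0 (nseq m.+1 0) i) nth_nseq if_same.
Qed.

Definition cvar (i a b : nat) : nat := 4 * cpair i (enc_seq (th l0 l1 a b)) + 1.
Definition cmul (p q : nat) : nat := 4 * cpair p q + 3.

Definition cgens (prog : seq instr) : seq nat :=
  gens cvar (fun p q => 4 * cpair p q + 2) cmul (enc_term (TConst M 1 (Negz 0)))
    (stX (size prog)).+1 (stX (size prog)) (exponent prog)
    (prog_u prog) (prog_v prog).

Definition gcode (prog : seq instr) : nat := enc_seq (cgens prog).

(* The number of variables is chosen after the code: the codes of the
   generators do not depend on it, and unused variables do no harm. *)
Definition halting_instance (prog : seq instr) : instance M :=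
  let c := gcode prog in
  existT _ c.+1 (tgoal c l0 l1 (stX 0) (2 ^ c),
    tgens c l0 l1 (stX (size prog)).+1 (stX (size prog)) (exponent prog)
      (prog_u prog) (prog_v prog)).

(** The code of a list exceeds those of its members, which exceed the indices of their variables;
    the generator t x_h carries the largest index. *)
Lemma bound_gcode prog : stX (size prog) < gcode prog.
Proof.
have : cmul (cvar 0 0 0) (cvar (stX (size prog)) 0 0) \in cgens prog.
  by rewrite mem_cat !inE eqxx !orbT.
move/mem_enc_seq; rewrite -/(gcode prog); apply: leq_trans.
rewrite ltnS /cmul; set p := cvar 0 0 0.
have := leq_cpair p (cvar (stX (size prog)) 0 0).
have := leq_cpair (stX (size prog)) (enc_seq (th l0 l1 0 0)).
rewrite /cvar; lia.
Qed.

Lemma enc_tvar n i a b : i < n.+1 -> enc_term (tvar n l0 l1 i a b) = cvar i a b.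
Proof. by move=> ilt; rewrite /= inordK. Qed.

Definition instance_encoder : cmd :=
  encoder (cvar 0 0 0) (cvar 1 0 0) (cvar 2 0 0) (enc_seq (nseq m.+1 0)).

(** The command itself does not depend on [prog], hence may be part of [prog]; only the input [c]
    does. *)
Lemma instance_encoder_correct prog (c := gcode prog) :
  den instance_encoder (c :: nseq 6 0) =
  enc_instance (halting_instance prog) :: nseq 6 0.
Proof.
have bnd : stX (size prog) < c := bound_gcode prog.
have c3 : 3 <= c by move: bnd; rewrite /stX; lia.
have gE : map (@enc_term M c.+1) (tgens c l0 l1 (stX (size prog)).+1
    (stX (size prog)) (exponent prog) (prog_u prog) (prog_v prog)) = cgens prog.
  apply: gens_morph => //; first 1 last.
  - by rewrite /stX; lia.
  - exact: bounded_u.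
  - exact: bounded_v.
  by move=> i a b iB; apply: enc_tvar; apply: leq_trans iB _; lia.
have goalE : enc_term (tgoal c l0 l1 (stX 0) (2 ^ c)) =
    goal cvar cmul (stX 0) (2 ^ c).
  by rewrite /goal -!(@enc_tvar c) //; move: bnd; rewrite /stX; lia.
rewrite [LHS]den_encoder; congr (_ :: _).
transitivity (cpair c.+1 (cpair (enc_term (tgoal c l0 l1 (stX 0) (2 ^ c)))
  (enc_seq (map (@enc_term M c.+1) (tgens c l0 l1 (stX (size prog)).+1
    (stX (size prog)) (exponent prog) (prog_u prog) (prog_v prog)))))); last by [].
rewrite gE goalE /goal /cmul [cvar (stX 0) _ _]/cvar enc_seq_th.
by [].
Qed.

Lemma halting_instance_member prog :
  member R (halting_instance prog) <-> halts prog (init (gcode prog)).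
Proof.
set c := gcode prog; set B := (stX (size prog)).+1.
have bnd : stX (size prog) < c := bound_gcode prog.
have l01 : l0 != l1 by [].
have hB : 2 < stX (size prog) < B by rewrite /B ltnSn andbT /stX; lia.
have Bn : B <= c.+1 by rewrite /B; lia.
have initE : init c = (0, decode (2 ^ c)) by rewrite decode_init.
have N0 : 0 < 2 ^ c by rewrite expn_gt0.
split=> [mem|h].
  have s3 : 2 < stX 0 <= c by move: bnd; rewrite /stX; lia.
  have := member_vanish l01 hB Bn (bounded_u prog) (bounded_v prog)
    (@separator_u prog R) (@separator_v prog R) (@separator_halt prog R) s3 mem.
  (* If the program ran forever, the vanishing value would be 1, against 1 <> 0 in [R]. *)
  rewrite separatorE /nonhalting N0 /= -initE.
  by case: asboolP => //= _ /eqP; rewrite GRing.oner_eq0.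
apply: reduces_member => //; [exact: bounded_u|exact: bounded_v|].
by have := @halts_reduces prog 0 _ N0; rewrite min0n -initE; apply.
Qed.

End Instances.

(* Phi : commutative ring with 1 <> 0 (comNzRingType = comNzRingType);
   Delta = {delta_0,...,delta_(m-1)} with m >= 2. *)
Theorem theorem2 (Phi : comNzRingType) (m : nat) (hm : (2 <= m)%N) :
  ~ exists prog : seq instr,
      decides (@enc_instance m) (@member Phi m) prog.
Proof.
case: m hm => [|[|m]] // _ [dec decP].
(* The instance concerns the run of [Q] on its own code: [Q] halts there exactly when [dec] denies
   that it does. *)
set Q := diagonal dec (instance_encoder m).
have [y [hy yP]] := decP (halting_instance m Q).
have := diagonal_correct (encoder_wf _ _ _ _) (encoder_preserves _ _ _ _)
  (instance_encoder_correct m Q) hy.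
by rewrite -/Q -(halting_instance_member Phi) yP; tauto.
Qed.
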